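(* Let $\gamma\subset\mathbb R^2$ be a self-affine Jordan arc, i.e. a Jordan arc which is the attractor of a finite system $\mathcal S=\{S_1,\dots,S_m\}$ of non-degenerate contracting affine maps of $\mathbb R^2$. If $\gamma$ is not a parabolic segment, then there is a self-affine multizipper $\mathcal Z$ in $\mathbb R^2$ such that $\gamma$ is one of the components of the attractor of $\mathcal Z$.
   Context: The attractor of a finite system $\mathcal S=\{S_1,\dots,S_m\}$ of contracting affine maps is the unique nonempty compact set $K$ with $K=\bigcup_{i=1}^m S_i(K)$. ''Contracting'' means having Lipschitz constant $<1$ in the Euclidean metric; an affine map is non-degenerate if its linear part is invertible. A parabolic segment is a (bounded, closed, non-degenerate) subarc of a parabola, where a straight line segment is regarded as a (degenerate) parabolic segment. A self-affine multizipper $\mathcal Z$ in $\mathbb R^2$ is given by a finite set $V$ and, for every $u\in V$, an integer $n_u\ge 1$, a chain of points $z^{(u)}_0,z^{(u)}_1,\dots,z^{(u)}_{n_u}\in\mathbb R^2$, and, for every $i\in\{1,\dots,n_u\}$, a vertex $v(u,i)\in V$ and a non-degenerate contracting affine map $T^{(u)}_i:\mathbb R^2\to\mathbb R^2$ which, with $v=v(u,i)$, maps the pair of points $\{z^{(v)}_0,z^{(v)}_{n_v}\}$ onto the pair $\{z^{(u)}_{i-1},z^{(u)}_i\}$ (in either order). In other words, it is a finite graph-directed system of contracting affine maps with vertex set $V$ and edges $u\to v(u,i)$, compatible with the chains of points. The attractor of $\mathcal Z$ is the unique family $(K_u)_{u\in V}$ of nonempty compact sets with $K_u=\bigcup_{i=1}^{n_u}T^{(u)}_i\big(K_{v(u,i)}\big)$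 for all $u\in V$; the sets $K_u$ are its components. *)

(* Defs.v *)
From HB Require Import structures.
From mathcomp Require Import all_boot all_order all_algebra.
From mathcomp Require Import all_classical all_reals all_analysis.
Set Implicit Arguments.
Unset Strict Implicit.
Unset Printing Implicit Defensive.
Import Order.TTheory GRing.Theory Num.Theory.
Import numFieldNormedType.Exports.
Local Open Scope classical_set_scope.
Local Open Scope ring_scope.

(* The library's norm `|x| on 'rV[R]_2 is the sup norm; its topology is the
   usual one, but contraction and parabolas refer to the Euclidean metric. *)
Definition dot (R : realType) (x y : 'rV[R]_2) : R := \sum_i x 0 i * y 0 i.

Definition enorm (R : realType) (x : 'rV[R]_2) : R := Num.sqrt (dot x x).

(* Points are row vectors, so linear parts act on the right. *)
Definition nondegenerate_affine (R : realType) (f : 'rV[R]_2 -> 'rV[R]_2) :=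
  exists (A : 'M[R]_2) (b : 'rV[R]_2),
    A \in unitmx /\ forall x, f x = x *m A + b.

Definition contracting (R : realType) (f : 'rV[R]_2 -> 'rV[R]_2) :=
  exists k : R, [/\ 0 <= k, k < 1 &
    forall x y, enorm (f x - f y) <= k * enorm (x - y)].

(* For contracting S, such a K is unique (Hutchinson's theorem), so this
   relation determines the attractor; likewise for multizipper_attractor. *)
Definition attractor (R : realType) (m : nat)
    (S : 'I_m -> 'rV[R]_2 -> 'rV[R]_2) (K : set 'rV[R]_2) :=
  [/\ K !=set0, compact K & K = \bigcup_(i in [set: 'I_m]) (S i @` K)].

Definition jordan_arc (R : realType) (gamma : set 'rV[R]_2) :=
  exists g : R -> 'rV[R]_2,
    [/\ {within `[0, 1], continuous g},
        set_inj `[0, 1] g &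
        gamma = g @` `[0, 1]].

(* The points equidistant from a focus F and a directrix, given as the line
   through q with unit normal vector w and required to miss F. *)
Definition parabola (R : realType) (P : set 'rV[R]_2) :=
  exists F q w : 'rV[R]_2,
    [/\ enorm w = 1, dot (F - q) w != 0 &
        P = [set x | enorm (x - F) = `|dot (x - q) w|]].

Definition line_segment (R : realType) (gamma : set 'rV[R]_2) :=
  exists a b : 'rV[R]_2,
    a != b /\ gamma = [set a + t *: (b - a) | t in `[0, 1]].

Definition parabolic_segment (R : realType) (gamma : set 'rV[R]_2) :=
  line_segment gamma \/
  (jordan_arc gamma /\ exists P, parabola P /\ gamma `<=` P).

(* Edges are numbered from 0: the map mz_map u i is T_{i+1}^{(u)}, attached to
   the pair of chain points z_i^{(u)}, z_{i+1}^{(u)}. *)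
Record multizipper (R : realType) := Multizipper {
  mz_vertex : finType;
  mz_len : mz_vertex -> nat;
  mz_chain : forall u, 'I_(mz_len u).+1 -> 'rV[R]_2;
  mz_target : forall u, 'I_(mz_len u) -> mz_vertex;
  mz_map : forall u, 'I_(mz_len u) -> 'rV[R]_2 -> 'rV[R]_2;
  mz_len_gt0 : forall u, (0 < mz_len u)%N;
  mz_map_affine : forall u i, nondegenerate_affine (@mz_map u i);
  mz_map_contracting : forall u i, contracting (@mz_map u i);
  mz_map_chain : forall u (i : 'I_(mz_len u)),
    @mz_map u i @` [set @mz_chain (mz_target i) ord0;
                        @mz_chain (mz_target i) ord_max] =
    [set @mz_chain u (widen_ord (leqnSn _) i); @mz_chain u (lift ord0 i)]
}.

Definition multizipper_attractor (R : realType) (Z : multizipper R)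
    (K : mz_vertex Z -> set 'rV[R]_2) :=
  forall u, [/\ K u !=set0, compact (K u) &
    K u = \bigcup_(i in [set: 'I_(mz_len u)])
            (mz_map i @` K (mz_target i))].

(* Main.v *)
Require Import Defs.
From HB Require Import structures.
From mathcomp Require Import all_boot all_order all_algebra.
From mathcomp Require Import all_classical all_reals all_analysis.
From mathcomp Require Import ring lra.
Set Implicit Arguments.
Unset Strict Implicit.
Unset Printing Implicit Defensive.
Import Order.TTheory GRing.Theory Num.Theory.
Import numFieldNormedType.Exports.
Local Open Scope classical_set_scope.
Local Open Scope ring_scope.

(** Parametrise the arc by the unit interval. The map of every word in the maps
    of the system sends the arc onto a subarc, called a cell, and the cells of
    each generation cover the arc. If cells met only at their ends, cutting the
    arc at the ends of the first generation would already be a zipper; but cells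
    may overlap, and then the pieces cut out of a cell depend on the positions,
    relative to this cell, of the ends of the others. The proof is a dichotomy
    on the positions that occur when the overlap is a definite portion of both
    cells: either there are finitely many of them ([rigid]), or the arc is a
    parabolic segment.

    In the rigid case all cut points can be chosen among finitely many types.
    A cut point close to an end of its cell is treated by zooming at this end:
    each zoom splits off a piece of a fixed type, and after finitely many zooms
    the position is one of finitely many ([finite_far], [decomposed_end]). A
    pair of cut points is treated by zooming until some cell of the next
    generation separates them ([decomposed_cut]). So the arcs between finitely
    many points are subdivided into contracted images of such arcs
    ([finite_types]), and they are the components of the attractor of a
    multizipper ([multizipper_of_types]).

    In the other case there are infinitely many affine maps that match definite
    subarcs of the arc. As no subarc lies on a line, these maps form a bounded
    family, and the quotient of two close ones is an affine map close to but
    distinct from the identity that sends a definite subarc into the arc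
    ([near_identity]). Its displacement, normalised, is close to an affine
    vector field. Conjugating by a deep contraction of the system enlarges the
    displacement while the trace and the determinant of its linear part are
    kept, so one may pass to a limit field with nilpotent linear part
    ([renormalise]). A field without trace is Hamiltonian, and its Hamiltonian
    is quadratic, with a degenerate quadratic part if the determinant also
    vanishes. Iterating the almost invariant maps is Euler's method for the
    limit field: the orbits follow the arc and almost conserve the Hamiltonian
    ([dense_orbits]), which is therefore constant on a subarc
    ([ham_constant]). A subarc contains an affine copy of the arc, hence the arc
    lies on a degenerate conic, which makes it a parabolic segment
    ([arc_in_conic]). *)

(** * Plane vectors and matrices *)

Lemma ord2P (i : 'I_2) : i = 0 \/ i = 1.
Proof. by case: i => [[|[|//]] H]; [left|right]; apply/val_inj. Qed.

Lemma row2P (R : realType) (x y : 'rV[R]_2) :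
  x 0 0 = y 0 0 -> x 0 1 = y 0 1 -> x = y.
Proof.
by move=> e0 e1; apply/rowP => i; case: (ord2P i) => ->.
Qed.

Lemma sum2 (R : nmodType) (F : 'I_2 -> R) : \sum_i F i = F 0 + F 1.
Proof. by rewrite big_ord_recl big_ord1; congr (_ + F _); apply/val_inj. Qed.

Lemma dotE (R : realType) (x y : 'rV[R]_2) :
  dot x y = x 0 0 * y 0 0 + x 0 1 * y 0 1.
Proof. by rewrite /dot sum2. Qed.

Lemma mulmx2E (R : realType) n p (x : 'M[R]_(n, 2)) (A : 'M[R]_(2, p)) i j :
  (x *m A) i j = x i 0 * A 0 j + x i 1 * A 1 j.
Proof. by rewrite mxE sum2. Qed.

Lemma det2E (R : realType) (A : 'M[R]_2) :
  \det A = A 0 0 * A 1 1 - A 0 1 * A 1 0.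
Proof.
rewrite (expand_det_row _ 0) sum2 /cofactor !det_mx11 !mxE /= expr0 expr1.
rewrite (_ : lift _ _ = 1); last exact/val_inj.
by rewrite (_ : lift _ _ = 0); [ring | exact/val_inj].
Qed.

Lemma tr2E (R : realType) (A : 'M[R]_2) : \tr A = A 0 0 + A 1 1.
Proof. exact: sum2. Qed.

Lemma entry_norm (R : realType) m n (A : 'M[R]_(m, n)) i j :
  `|A i j| <= `|A|.
Proof.
rewrite [leRHS]/Num.norm /= mx_normrE; apply/bigmax_geP; right.
by exists (i, j).
Qed.

Lemma norm_entries (R : realType) m n (A : 'M[R]_(m, n)) c :
  0 <= c -> (forall i j, `|A i j| <= c) -> `|A| <= c.
Proof.
move=> c0 Ac; rewrite [leLHS]/Num.norm /= mx_normrE.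
by apply/bigmax_leP; split => // -[i j] _.
Qed.

Lemma mulmx_norm (R : realType) m n (A : 'M[R]_(m, 2)) (B : 'M[R]_(2, n)) :
  `|A *m B| <= 2 * `|A| * `|B|.
Proof.
apply: norm_entries => [|i j]; first by rewrite !mulr_ge0.
rewrite mulmx2E -mulrA mulr_natl mulr2n; apply: le_trans (ler_normD _ _) _.
by rewrite !normrM lerD // ler_pM // entry_norm.
Qed.

Lemma enorm_ge0 (R : realType) (x : 'rV[R]_2) : 0 <= enorm x.
Proof. exact: sqrtr_ge0. Qed.

Lemma norm_le_enorm (R : realType) (x : 'rV[R]_2) : `|x| <= enorm x.
Proof.
apply: norm_entries => [|i j]; first exact: enorm_ge0.
rewrite (ord1 i) -sqrtr_sqr /enorm ler_wsqrtr // dotE -!expr2.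
by case: (ord2P j) => ->; rewrite ?lerDl ?lerDr sqr_ge0.
Qed.

Lemma enorm_le_norm (R : realType) (x : 'rV[R]_2) : enorm x <= 2 * `|x|.
Proof.
rewrite -(@ger0_norm _ (2 * `|x|)) ?mulr_ge0 // -sqrtr_sqr ler_wsqrtr // dotE.
have h j : x 0 j * x 0 j <= `|x| ^+ 2.
  by rewrite -expr2 -real_normK ?num_real // lerXn2r ?nnegrE // entry_norm.
by have := h 0; have := h 1; have := sqr_ge0 `|x|; lra.
Qed.

(** * Parametrisations of an arc *)

(** Precomposing a parametrisation with [clamp] extends it by constants to a
    continuous function on the whole line, which spares the subspace topology
    of the unit interval. *)
Definition clamp (R : realType) (t : R) : R := Num.max 0 (Num.min t 1).

Lemma clamp_id (R : realType) (t : R) : 0 <= t <= 1 -> clamp t = t.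
Proof.
by case/andP => t0 t1; rewrite /clamp (min_idPl t1) (max_idPr t0).
Qed.

Lemma clamp_itv (R : realType) (t : R) : 0 <= clamp t <= 1.
Proof. by rewrite /clamp le_max lexx /= ge_max ler01 ge_min lexx orbT. Qed.

Lemma clamp_continuous (R : realType) : continuous (@clamp R).
Proof.
move=> t; apply: (@continuous_max R R (cst 0) (fun s => Num.min s 1) t).
  exact: cvg_cst.
by apply: (@continuous_min R R id (cst 1) t); [exact: cvg_id|exact: cvg_cst].
Qed.

Lemma jordan_param (R : realType) (gamma : set 'rV[R]_2) :
  jordan_arc gamma -> exists G : R -> 'rV[R]_2,
    [/\ continuous G,
        (forall s t, 0 <= s <= 1 -> 0 <= t <= 1 -> G s = G t -> s = t) &
        gamma = G @` `[0, 1]].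
Proof.
move=> [g [cg ig ->]]; exists (g \o @clamp R); split.
- move=> t.
  have ct : @clamp R x @[x --> t] --> within `[0, 1] (nbhs (clamp t)).
    move=> U; rewrite /within /= => nU.
    have h : \forall s \near t, `[0, 1]%classic (clamp s) -> U (clamp s) :=
      @clamp_continuous R t _ nU.
    suff : \forall s \near t, U (clamp s) by [].
    apply: filterS h => s; apply; rewrite /= in_itv; exact: clamp_itv.
  apply: (@cvg_comp _ _ _ (@clamp R) g _ _ _ ct).
  move/subspace_continuousP: cg; apply.
  by rewrite /= in_itv; exact: clamp_itv.
- move=> s t s01 t01 /=; rewrite !clamp_id //.
  by apply: ig; rewrite inE /= in_itv.
- by apply: eq_imagel => t; rewrite /= in_itv /= => t01; rewrite clamp_id.
Qed.

(** On the compact set where [eta <= psi] the function [phi] does not vanish,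
    so its minimum there is the modulus. *)
Lemma compact_modulus (R : realType) (T : topologicalType) (C : set T)
    (phi psi : T -> R) (eta : R) :
  compact C -> closed C -> continuous phi -> continuous psi ->
  (forall z, C z -> 0 <= phi z) -> (forall z, C z -> phi z = 0 -> psi z < eta) ->
  exists2 rho, 0 < rho & forall z, C z -> phi z < rho -> psi z < eta.
Proof.
move=> cC clC cphi cpsi phi0 phipsi.
pose K := C `&` psi @^-1` [set y | eta <= y].
have cK : compact K.
  apply: (subclosed_compact _ cC); last by move=> z [].
  apply: closedI => //; apply: (preimage_closed _ (@closed_ge _ eta)) => z _.
  exact: cpsi.
case: (pselect (K !=set0)) => [K0|K0]; last first.
  exists 1 => // z Cz _; rewrite ltNge; apply/negP => h.
  by apply: K0; exists z.
have [z zK zmin] := compact_EVT_min K0 cK (continuous_subspaceT cphi).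
move: zK; rewrite inE => -[Cz /= etaz].
exists (phi z).
  rewrite lt_neqAle phi0 // andbT eq_sym; apply/eqP => /phipsi -/(_ Cz).
  by rewrite ltNge etaz.
move=> y Cy; apply: contraTT; rewrite -!leNgt => h.
by apply: zmin; rewrite inE.
Qed.

Lemma square_compact (R : realType) :
  compact (`[(0 : R), 1] `*` `[(0 : R), 1]) /\
  closed (`[(0 : R), 1] `*` `[(0 : R), 1]).
Proof.
have c := compact_setX (segment_compact (a := (0 : R)) (b := 1))
                       (segment_compact (a := (0 : R)) (b := 1)).
by split => //; apply: compact_closed c; exact: norm_hausdorff.
Qed.

Lemma continuous_dist (R : realType) (V : normedModType R) (f : R -> V) :
  continuous f -> continuous (fun z : R * R => `|f z.1 - f z.2|).
Proof.
move=> cf z; apply: cvg_norm; apply: cvgB.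
  by apply: (@cvg_comp _ _ _ fst f _ (nbhs z.1)); [exact: cvg_fst|exact: cf].
by apply: (@cvg_comp _ _ _ snd f _ (nbhs z.2)); [exact: cvg_snd|exact: cf].
Qed.

(** This covers the uniform continuity of [f] as well as that of its inverse
    when [f] is injective: the identity is taken for [f] in the former case and
    for [h] in the latter. *)
Lemma param_modulus (R : realType) (V W : normedModType R)
    (f : R -> V) (h : R -> W) (eta : R) :
  continuous f -> continuous h -> 0 < eta ->
  (forall s t, 0 <= s <= 1 -> 0 <= t <= 1 -> f s = f t -> h s = h t) ->
  exists2 rho, 0 < rho & forall s t, 0 <= s <= 1 -> 0 <= t <= 1 ->
    `|f s - f t| < rho -> `|h s - h t| < eta.
Proof.
move=> cf ch eta0 fh; have [cC clC] := @square_compact R.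
have [//|z [/= z1 z2]|rho rho0 H] :=
    compact_modulus (eta := eta) cC clC (continuous_dist cf)
      (continuous_dist ch).
  move=> /eqP; rewrite normr_eq0 subr_eq0 => /eqP e.
  by rewrite (fh z.1 z.2) ?subrr ?normr0 //; move: z1 z2; rewrite /= !in_itv.
exists rho => // s t s01 t01; apply: (H (s, t)).
by split; rewrite /= in_itv.
Qed.

(** * Order on the unit interval *)

Section Between.
Context (R : realType).
Implicit Types (x y z t : R) (u : R -> R).

(** The end points [x] and [y] are unordered because the maps of the system may
    reverse the orientation of the arc. *)
Definition btw x y z := (x <= z <= y) || (y <= z <= x).

Definition in01 x := 0 <= x <= 1.

Lemma in01_0 : in01 0. Proof. by rewrite /in01 lexx ler01. Qed.
Lemma in01_1 : in01 1. Proof. by rewrite /in01 lexx ler01. Qed.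

Lemma btwC x y z : btw x y z = btw y x z.
Proof. by rewrite /btw orbC. Qed.

Lemma btwl x y : btw x y x.
Proof. by rewrite /btw; lra. Qed.

Lemma btwr x y : btw x y y.
Proof. by rewrite /btw; lra. Qed.

Lemma btw_eq x z : btw x x z -> z = x.
Proof. by rewrite /btw; lra. Qed.

Lemma btw_trans x y a b z : btw x y a -> btw x y b -> btw a b z -> btw x y z.
Proof. by rewrite /btw; lra. Qed.

Lemma btw_in01 x y z : in01 x -> in01 y -> btw x y z -> in01 z.
Proof. by rewrite /in01 /btw; lra. Qed.

Lemma inj_cont_mono u : continuous u ->
  (forall x y, in01 x -> in01 y -> u x = u y -> x = y) ->
  (forall x y, in01 x -> in01 y -> (u x <= u y) = (x <= y)) \/
  (forall x y, in01 x -> in01 y -> (u x <= u y) = (y <= x)).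
Proof.
move=> cu iu.
have := @itv_continuous_inj_mono R u `[0, 1] (continuous_subspaceT cu).
case.
- by move=> x y; rewrite !in_itv => x01 y01; exact: iu.
- move=> h; left=> x y x01 y01; apply: (le_mono_in h); by rewrite in_itv.
- move=> h; right=> x y x01 y01; apply: (le_nmono_in h); by rewrite in_itv.
Qed.

Lemma inj_cont_btw u : continuous u ->
  (forall x y, in01 x -> in01 y -> u x = u y -> x = y) ->
  forall x y z, in01 x -> in01 y -> in01 z ->
    btw (u x) (u y) (u z) = btw x y z.
Proof.
move=> cu iu x y z x01 y01 z01.
case: (inj_cont_mono cu iu) => h; rewrite /btw !h //.
by rewrite orbC [in LHS]andbC [X in _ || X]andbC.
Qed.

Lemma btw_ivt u x y v : continuous u -> btw (u x) (u y) v ->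
  exists2 z, btw x y z & u z = v.
Proof.
move=> cu; wlog xy : x y / x <= y => [H|].
  case: (leP x y) => [|/ltW] xy uv; first exact: H.
  have [z bz <-] := H _ _ xy (etrans (btwC _ _ _) uv).
  by exists z; rewrite // btwC.
move=> uv; have [|z] := IVT xy (continuous_subspaceT cu) (v := v).
  by move: uv; rewrite /btw; case: (lerP (u x) (u y)); lra.
rewrite in_itv /= => xzy <-; exists z => //.
by rewrite /btw xzy.
Qed.

End Between.

(** * Arcs contained in lines and in degenerate conics *)

Lemma continuous_coord (R : realType) (G : R -> 'rV[R]_2) j :
  continuous G -> continuous (fun t => G t 0 j).
Proof.
move=> cG t.
by apply: (@cvg_comp _ _ _ G (fun M : 'rV[R]_2 => M 0 j) _ (nbhs (G t)));
  [exact: cG | exact: coord_continuous].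
Qed.

(** The coordinate along the line is injective on the arc, and its values form
    an interval. *)
Lemma arc_in_line (R : realType) (gamma : set 'rV[R]_2) (n1 n2 c : R) :
  jordan_arc gamma -> n1 ^+ 2 + n2 ^+ 2 != 0 ->
  (forall x, gamma x -> n1 * x 0 0 + n2 * x 0 1 = c) -> line_segment gamma.
Proof.
move=> /jordan_param [G [cG iG ->]] n0 on_line.
set N := n1 ^+ 2 + n2 ^+ 2 in n0.
have on_lineG t : in01 t -> n1 * G t 0 0 + n2 * G t 0 1 = c.
  by move=> t01; apply: on_line; exists t; rewrite //= in_itv.
pose u t := n1 * G t 0 1 - n2 * G t 0 0.
have G0 t : in01 t -> G t 0 0 = (n1 * c - n2 * u t) / N.
  by move=> /on_lineG <-; rewrite /u /N; field.
have G1 t : in01 t -> G t 0 1 = (n2 * c + n1 * u t) / N.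
  by move=> /on_lineG <-; rewrite /u /N; field.
have cu : continuous u.
  by move=> t; apply: cvgB; apply: cvgMr; exact: continuous_coord.
have iu x y : in01 x -> in01 y -> u x = u y -> x = y.
  move=> x01 y01 e; apply: iG => //; apply: row2P.
    by rewrite !G0 // e.
  by rewrite !G1 // e.
have ne01 : (0 : R) = 1 -> False by move/eqP; rewrite eq_sym oner_eq0.
exists (G 0), (G 1); split.
  by apply/eqP => /(iG _ _ (in01_0 R) (in01_1 R)).
have u01 : u 1 - u 0 != 0.
  by rewrite subr_eq0; apply/eqP => /(iu _ _ (in01_1 R) (in01_0 R)) /esym.
have Gaff t s : in01 t -> u t = u 0 + s * (u 1 - u 0) ->
    G t = G 0 + s *: (G 1 - G 0).
  move=> t01 e; apply: row2P; rewrite !mxE.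
    by rewrite !(G0 _ (in01_0 R), G0 _ (in01_1 R), G0 _ t01) e; field.
  by rewrite !(G1 _ (in01_0 R), G1 _ (in01_1 R), G1 _ t01) e; field.
apply/seteqP; split => p [t /=]; rewrite in_itv /= => t01 <-.
  exists ((u t - u 0) / (u 1 - u 0)); last first.
    by apply/esym/Gaff => //; field.
  have : btw (u 0) (u 1) (u t).
    rewrite (inj_cont_btw cu iu (in01_0 R) (in01_1 R) t01).
    by rewrite /btw t01.
  rewrite /= in_itv /= /btw.
  case: (ltrgtP (u 1 - u 0) 0) u01 => // h _ ut.
    by rewrite ler_ndivlMr // ler_ndivrMr //; lra.
  by rewrite ler_pdivlMr // ler_pdivrMr //; lra.
have [|z z01 ez] := @btw_ivt R u 0 1 (u 0 + t * (u 1 - u 0)) cu.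
  by rewrite /btw; case: (ltrgtP (u 0) (u 1)) => h; nra.
have {}z01 : in01 z by move: z01; rewrite /btw /in01; lra.
by exists z; rewrite /= ?in_itv //=; exact: Gaff.
Qed.

(** A positive form of rank one is the square of a linear functional; the
    functional is normalised to serve as a unit normal vector. *)
Lemma rank_one_form (R : realType) (A B C : R) : B ^+ 2 = A * C -> 0 < A + C ->
  exists n1 n2 : R, [/\ n1 ^+ 2 = A / (A + C), n2 ^+ 2 = C / (A + C),
    n1 * n2 = B / (A + C) & n1 ^+ 2 + n2 ^+ 2 = 1].
Proof.
move=> BAC N0; have AC0 : 0 <= A * C by rewrite -BAC sqr_ge0.
have A0 : 0 <= A / (A + C).
  by rewrite divr_ge0 ?(ltW N0) //; case: (lerP 0 A) => // h; nra.
have C0 : 0 <= C / (A + C).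
  by rewrite divr_ge0 ?(ltW N0) //; case: (lerP 0 C) => // h; nra.
have prodE : Num.sqrt (A / (A + C)) * Num.sqrt (C / (A + C)) = `|B| / (A + C).
  have -> : `|B| / (A + C) = `|B / (A + C)| by rewrite normf_div (gtr0_norm N0).
  rewrite -sqrtrM // -sqrtr_sqr; congr Num.sqrt.
  by rewrite expr_div_n BAC; field; lra.
have N1 : A / (A + C) + C / (A + C) = 1 by field; lra.
exists (Num.sqrt (A / (A + C))); case: (lerP 0 B) => hB.
  exists (Num.sqrt (C / (A + C))); rewrite !sqr_sqrtr //; split=> //.
  by rewrite prodE ger0_norm.
exists (- Num.sqrt (C / (A + C))); rewrite sqrrN !sqr_sqrtr //; split=> //.
by rewrite mulrN prodE ltr0_norm // mulNr opprK.
Qed.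

(** A conic whose quadratic part is degenerate is a parabola, a pair of
    parallel lines or a line; an arc in a pair of parallel lines lies in one
    of them because it is connected. *)
Lemma arc_in_conic (R : realType) (gamma : set 'rV[R]_2) (A B C D E K : R) :
  jordan_arc gamma -> B ^+ 2 = A * C ->
  ~ [/\ A = 0, C = 0, D = 0 & E = 0] ->
  (forall x, gamma x -> A * x 0 0 ^+ 2 + 2 * B * x 0 0 * x 0 1 + C * x 0 1 ^+ 2
     + D * x 0 0 + E * x 0 1 + K = 0) ->
  parabolic_segment gamma.
Proof.
move=> arc; wlog AC : A B C D E K / 0 <= A + C => [H|].
  case: (lerP 0 (A + C)) => [|h] BAC nz on; first exact: H BAC nz on.
  apply: (H (- A) (- B) (- C) (- D) (- E) (- K)); first lra.
  - by rewrite sqrrN mulrNN.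
  - by case=> /eqP; rewrite oppr_eq0 => /eqP A0 /eqP; rewrite oppr_eq0 => /eqP;
      move: h; lra.
  - by move=> x /on; lra.
move=> BAC nz on; have B2 := sqr_ge0 B.
move: AC; rewrite le_eqVlt => /orP[/eqP AC|AC].
  have A0 : A = 0 by nra.
  have C0 : C = 0 by nra.
  have B0 : B = 0 by apply/eqP; rewrite -sqrf_eq0 BAC A0 mul0r.
  left; apply: (@arc_in_line _ _ D E (- K)) => //.
    apply/eqP => h; apply: nz; have := sqr_ge0 D; have := sqr_ge0 E => E2 D2.
    have /eqP : D ^+ 2 = 0 by lra.
    have /eqP : E ^+ 2 = 0 by lra.
    by rewrite !sqrf_eq0 => /eqP -> /eqP ->.
  by move=> x /on; rewrite A0 B0 C0; lra.
have [n1 [n2 [n1E n2E n12 n1n2]]] := rank_one_form BAC AC.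
set N := A + C in AC n1E n2E n12.
have N0 : N != 0 by lra.
set d := D * n1 + E * n2; set e := E * n1 - D * n2.
have {}on x : gamma x -> N * (n1 * x 0 0 + n2 * x 0 1) ^+ 2 +
    d * (n1 * x 0 0 + n2 * x 0 1) + e * (n1 * x 0 1 - n2 * x 0 0) + K = 0.
  move=> /on <-.
  have -> : A = N * n1 ^+ 2 by rewrite n1E; field.
  have -> : C = N * n2 ^+ 2 by rewrite n2E; field.
  have -> : B = N * (n1 * n2) by rewrite n12; field.
  have -> : D = D * (n1 ^+ 2 + n2 ^+ 2) by rewrite n1n2 mulr1.
  have -> : E = E * (n1 ^+ 2 + n2 ^+ 2) by rewrite n1n2 mulr1.
  rewrite /d /e; ring.
case: (eqVneq e 0) => e0.
  left; have [G [cG _ gE]] := jordan_param arc.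
  pose a t := n1 * G t 0 0 + n2 * G t 0 1.
  have ca : continuous a.
    by move=> t; apply: cvgD; apply: cvgMr; exact: continuous_coord.
  have root t : in01 t -> N * a t ^+ 2 + d * a t + K = 0.
    move=> t01; have /on : gamma (G t) by rewrite gE; exists t; rewrite //= in_itv.
    by rewrite e0 mul0r addr0.
  apply: (@arc_in_line _ _ n1 n2 (a 0)) => //; first by rewrite n1n2 oner_neq0.
  rewrite gE => x [t]; rewrite /= in_itv /= => t01 <-; rewrite -/(a t).
  have [|m m01 mE] := @btw_ivt R a 0 t ((a 0 + a t) / 2) ca.
    by rewrite /btw; case: (lerP (a 0) (a t)); lra.
  have := root _ (btw_in01 (in01_0 R) t01 m01); rewrite mE.
  have := root _ (in01_0 R); have := root _ t01 => h1 h2 h3.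
  have /eqP : N * (a t - a 0) ^+ 2 = 0 by lra.
  by rewrite mulf_eq0 (negPf N0) sqrf_eq0 subr_eq0 => /eqP.
(* in the orthonormal frame with first vector (n1, n2) and centred suitably the
   equation is u ^ 2 = - eps * v: the focus is at v = - eps / 4 and the directrix
   at v = eps / 4 *)
right; split => //.
pose eps := e / N; pose f := (K - d ^+ 2 / (4 * N)) / e.
pose vec (a b : R) : 'rV[R]_2 :=
  \row_j (if j == 0 then n1 * a - n2 * b else n2 * a + n1 * b).
exists [set x | enorm (x - vec (- d / (2 * N)) (- eps / 4 - f)) =
    `|dot (x - vec 0 (eps / 4 - f)) (vec 0 1)|]; split.
  exists (vec (- d / (2 * N)) (- eps / 4 - f)), (vec 0 (eps / 4 - f)), (vec 0 1).
  split => //.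
    rewrite /enorm (_ : dot _ _ = 1) ?sqrtr1 // dotE !mxE /= -[RHS]n1n2; ring.
  have -> : dot (vec (- d / (2 * N)) (- eps / 4 - f) - vec 0 (eps / 4 - f))
      (vec 0 1) = - (eps / 2) * (n1 ^+ 2 + n2 ^+ 2).
    by rewrite dotE !mxE /=; field.
  by rewrite n1n2 mulr1 oppr_eq0 !mulf_neq0 ?invr_eq0 // pnatr_eq0.
move=> x /on; set a := n1 * x 0 0 + n2 * x 0 1.
set b := n1 * x 0 1 - n2 * x 0 0 => h /=.
have -> : x = vec a b.
  apply: row2P; rewrite !mxE /= /a /b.
    by rewrite -[LHS]mul1r -n1n2; ring.
  by rewrite -[LHS]mul1r -n1n2; ring.
rewrite -sqrtr_sqr /enorm; congr Num.sqrt.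
have -> : dot (vec a b - vec 0 (eps / 4 - f)) (vec 0 1) =
    (b + f - eps / 4) * (n1 ^+ 2 + n2 ^+ 2) by rewrite dotE !mxE /=; field.
rewrite n1n2 mulr1.
have -> : dot (vec a b - vec (- d / (2 * N)) (- eps / 4 - f))
    (vec a b - vec (- d / (2 * N)) (- eps / 4 - f)) =
    ((a + d / (2 * N)) ^+ 2 + (b + f + eps / 4) ^+ 2) * (n1 ^+ 2 + n2 ^+ 2).
  by rewrite dotE !mxE /=; field.
rewrite n1n2 mulr1; apply/eqP; rewrite -subr_eq0; apply/eqP.
transitivity ((N * a ^+ 2 + d * a + e * b + K) / N); last by rewrite h mul0r.
by rewrite /eps /f; field; rewrite e0 N0.
Qed.

(** * Affine vector fields and their conserved quadratic functions *)

Section AffineFields.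
Context (R : realType).
Implicit Types (x y u v b c p : 'rV[R]_2) (L A : 'M[R]_2).

Definition fld L b x := x *m L + b.

Definition omega u v : R := u 0 0 * v 0 1 - u 0 1 * v 0 0.

(** A divergence-free affine field is Hamiltonian; this is its Hamiltonian. *)
Definition ham L b x := omega (x *m L) x / 2 + omega b x.

Lemma omega_mulmx u v A : omega (u *m A) (v *m A) = \det A * omega u v.
Proof. by rewrite /omega det2E !mulmx2E; ring. Qed.

Lemma omega_norm u v : `|omega u v| <= 2 * `|u| * `|v|.
Proof.
rewrite -mulrA mulr_natl mulr2n; apply: le_trans (ler_normB _ _) _.
by rewrite !normrM lerD // ler_pM // entry_norm.
Qed.

Lemma traceless L : \tr L = 0 -> L 1 1 = - L 0 0.
Proof. by rewrite tr2E; lra. Qed.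

Lemma ham_add L b x y : \tr L = 0 ->
  ham L b (x + y) = ham L b x + omega (fld L b x) y + omega (y *m L) y / 2.
Proof.
by move=> /traceless t; rewrite /ham /fld /omega !(mulmx2E, mxE) t; field.
Qed.

(** Along an Euler step the Hamiltonian changes only by the error of the field
    and by a term of second order, since [omega (fld L b x)] kills the field. *)
Lemma ham_flow L b x y (n : R) : \tr L = 0 ->
  ham L b (x + n *: y) - ham L b x =
  n * (omega (fld L b x) (y - fld L b x) + n * (omega (y *m L) y / 2)).
Proof.
by move=> t; rewrite ham_add // -scalemxAl /omega !(mulmx2E, mxE); field.
Qed.

(** An affine change of coordinates transports the Hamiltonian of a field to a
    multiple of the Hamiltonian of the conjugate field. *)
Lemma ham_pull L b A c L' b' x : \tr L = 0 -> L' *m A = A *m L ->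
  b' *m A = fld L b c ->
  ham L b (x *m A + c) = \det A * ham L' b' x + ham L b c.
Proof.
move=> t eL eb; rewrite addrC ham_add // -eb {2}/ham.
rewrite -mulmxA -eL mulmxA !omega_mulmx; ring.
Qed.

(** The level sets of the Hamiltonian are conics, whose quadratic part has
    discriminant proportional to [\det L]. *)
Lemma ham_arc (gamma : set 'rV[R]_2) L b k : jordan_arc gamma ->
  \tr L = 0 -> \det L = 0 -> ~ (L = 0 /\ b = 0) ->
  (forall x, gamma x -> ham L b x = k) -> parabolic_segment gamma.
Proof.
move=> arc /traceless t; rewrite det2E t => d nz on.
apply: (@arc_in_conic _ _ (- L 0 1 / 2) (L 0 0 / 2) (L 1 0 / 2) (- b 0 1)
  (b 0 0) (- k) arc).
- by lra.
- case=> h1 h2 h3 h4; apply: nz.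
  have L01 : L 0 1 = 0 by lra.
  have L10 : L 1 0 = 0 by lra.
  have L00 : L 0 0 = 0.
    apply/eqP; rewrite -sqrf_eq0 expr2; apply/eqP; move: d.
    by rewrite L01 mul0r; lra.
  split; last by apply: row2P; rewrite mxE; lra.
  by apply/matrixP => i j; rewrite mxE;
    case: (ord2P i) => ->; case: (ord2P j) => -> //; rewrite t L00 oppr0.
- by move=> x /on <-; rewrite /ham /omega !mulmx2E t; field.
Qed.

Lemma fld_norm L b x : `|fld L b x| <= 2 * `|x| * `|L| + `|b|.
Proof. by rewrite (le_trans (ler_normD _ _)) // lerD2r mulmx_norm. Qed.

Lemma fld_sub L b L' b' x : fld L b x - fld L' b' x = fld (L - L') (b - b') x.
Proof. by rewrite /fld mulmxBr opprD addrACA. Qed.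

End AffineFields.

(** * Arcs that are almost invariant under small affine displacements *)

(** The discrete intermediate value theorem. *)
Lemma discrete_crossing (R : realType) (s : nat -> R) (K : nat) (t eta : R) :
  0 < eta -> s 0%N <= t <= s K ->
  (forall k, (k < K)%N -> `|s k.+1 - s k| < eta) ->
  exists2 k, (k <= K)%N & `|t - s k| < eta.
Proof.
move=> eta0; elim: K => [|K IH] /andP[h0 hK] step.
  by exists 0%N => //; rewrite (_ : t = s 0%N) ?subrr ?normr0 //; lra.
case: (lerP t (s K)) => h.
  have [|k kK hk] := IH _ (fun k kK => step k (ltnW kK)); first by rewrite h0.
  by exists k => //; rewrite (leq_trans kK).
exists K => //; apply: le_lt_trans (step K (ltnSn K)).
by rewrite !ger0_norm; lra.
Qed.

Section ArcFlow.
Context (R : realType) (G : R -> 'rV[R]_2).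
Hypothesis cG : continuous G.
Hypothesis iG : forall s t, in01 s -> in01 t -> G s = G t -> s = t.

Definition middle (t : R) := 1 / 4 <= t <= 3 / 4.

(** Near the base point the field is almost constant, so the orbit stays close
    to uniform motion; this keeps it in the region where the next step is known
    to stay on the arc. *)
Lemma euler_orbit (f : 'rV[R]_2 -> 'rV[R]_2) (v : 'rV[R]_2) (t0 n r : R) (K : nat) :
  in01 t0 -> 0 < n -> 0 < r ->
  (forall t, in01 t -> `|G t - G t0| < r -> middle t) ->
  (forall x, `|x - G t0| < r -> `|f x - v| <= `|v| / 4) ->
  (forall t, middle t -> exists2 t', in01 t' & G t' = G t + n *: f (G t)) ->
  K%:R * n * `|v| * 2 <= r ->
  exists s : nat -> R, s 0%N = t0 /\ forall k, (k <= K)%N ->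
    [/\ in01 (s k), `|G (s k) - G t0| < r,
      `|G (s k) - G t0 - (k%:R * n) *: v| <= k%:R * n * (`|v| / 4) &
      (k < K)%N -> G (s k.+1) = G (s k) + n *: f (G (s k))].
Proof.
move=> t001 n0 r0 inmid close stay Kr.
have /choice[next nextP] : forall t, exists t', middle t ->
    in01 t' /\ G t' = G t + n *: f (G t).
  move=> t; case: (pselect (middle t)) => [/stay[t' t'01 e]|h]; first by exists t'.
  by exists t => /h.
pose s k := iter k next t0; exists s; split=> //.
(* the length K n |v| is at most r / 2, and the drift adds at most a quarter *)
have near k : (k <= K)%N ->
    `|G (s k) - G t0 - (k%:R * n) *: v| <= k%:R * n * (`|v| / 4) ->
    `|G (s k) - G t0| < r.
  move=> kK h.
  have := ler_normD (G (s k) - G t0 - (k%:R * n) *: v) ((k%:R * n) *: v).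
  rewrite subrK normrZ (ger0_norm (mulr_ge0 (ler0n R k) (ltW n0))) => h2.
  have kKr : k%:R * n * `|v| <= K%:R * n * `|v|.
    by rewrite ler_wpM2r // ler_wpM2r ?ler_nat // ltW.
  by have := normr_ge0 v; nra.
have main k : (k <= K)%N -> in01 (s k) /\
    `|G (s k) - G t0 - (k%:R * n) *: v| <= k%:R * n * (`|v| / 4).
  elim: k => [|k IH] kK; first by rewrite /s /= subrr !mul0r scale0r subr0 normr0.
  have [k01 dk] := IH (ltnW kK).
  have rk := near k (ltnW kK) dk.
  have [k1 ek] := nextP _ (inmid _ k01 rk); split => //.
  rewrite /s iterS -/(s k) ek.
  rewrite (_ : _ - _ = (G (s k) - G t0 - (k%:R * n) *: v) +
    n *: (f (G (s k)) - v)); last first.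
    rewrite -natr1 mulrDl mul1r scalerDl scalerBr !opprD !addrA.
    by rewrite [G (s k) + _ - _]addrAC -!addrA; congr (_ + (_ + _)); rewrite addrCA.
  apply: le_trans (ler_normD _ _) _.
  rewrite -natr1 mulrDl mul1r mulrDl lerD // normrZ (gtr0_norm n0).
  by rewrite ler_wpM2l ?(ltW n0) // close.
move=> k kK; have [k01 dk] := main k kK; split => //; first exact: near.
by move=> _; have [_ ->] := nextP _ (inmid _ k01 (near k kK dk)).
Qed.

(** One [e] bounds the step [n] and the error of the field, so iterating these
    maps is Euler's method for the field [(L0, b0)]. *)
Definition almost_invariant (L0 : 'M[R]_2) (b0 : 'rV[R]_2) :=
  forall e, 0 < e -> exists n L b, [/\ 0 < n < e, `|L - L0| <= e, `|b - b0| <= e &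
    forall t, middle t -> exists2 t', in01 t' & G t' = G t + n *: fld L b (G t)].

(** An orbit runs for a time [tau] that does not depend on the step, so it
    covers a definite distance by steps that tend to zero, while the energy
    errors of its steps add up to at most a multiple of [tau] times the error of
    the field. *)
Lemma dense_orbits (L0 : 'M[R]_2) (b0 : 'rV[R]_2) (t0 : R) :
  \tr L0 = 0 -> 1 / 4 < t0 < 3 / 4 -> fld L0 b0 (G t0) != 0 ->
  almost_invariant L0 b0 ->
  exists2 zeta, 0 < zeta & forall eta, 0 < eta ->
    exists (s : nat -> R) (K : nat), [/\ s 0%N = t0,
      forall k, (k <= K)%N -> in01 (s k) /\
        `|ham L0 b0 (G (s k)) - ham L0 b0 (G t0)| <= eta,
      forall k, (k < K)%N -> `|s k.+1 - s k| < eta & zeta <= `|s K - t0|].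
Proof.
move=> trL t0mid v0 inv.
have t001 : in01 t0 by rewrite /in01; lra.
set p := G t0; set v := fld L0 b0 p; rewrite -/p -/v in v0.
have nv : 0 < `|v| by rewrite normr_gt0.
(* radius in which the arc stays in its middle part and the field is almost
   constant *)
have mu0 : 0 < Num.min (t0 - 1 / 4) (3 / 4 - t0) by rewrite lt_min; lra.
have [rho rho0 Hrho] := param_modulus cG (fun t => @cvg_id _ (nbhs t)) mu0 iG.
pose r := Num.min 1 (Num.min rho (`|v| / (16 * (`|L0| + 1)))).
have L1 : 0 < `|L0| + 1 by rewrite ltr_wpDl.
have r0 : 0 < r by rewrite !lt_min ltr01 rho0 divr_gt0 // mulr_gt0.
have r1 : r <= 1 by rewrite ge_min lexx.
have rrho : r <= rho by rewrite !ge_min lexx /= orbT.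
have rL : r * (16 * (`|L0| + 1)) <= `|v|.
  by rewrite -ler_pdivlMr ?mulr_gt0 // !ge_min lexx !orbT.
have inmid t : in01 t -> `|G t - p| < r -> middle t.
  move=> t01 h; have := Hrho t t0 t01 t001 (lt_le_trans h rrho).
  by rewrite lt_min !ltr_norml /middle; lra.
pose tau := r / (2 * `|v|).
have tau0 : 0 < tau by rewrite divr_gt0 // mulr_gt0.
have tauv : tau * (2 * `|v|) = r by rewrite /tau; field; lra.
have d0 : 0 < 3 * r / 16 by rewrite divr_gt0 ?mulr_gt0.
have [zeta zeta0 Hzeta] := param_modulus (fun t => @cvg_id _ (nbhs t)) cG d0
  (fun s t _ _ => @congr1 _ _ G s t).
exists zeta => // eta eta0.
have [rho' rho'0 Hrho'] := param_modulus cG (fun t => @cvg_id _ (nbhs t)) eta0 iG.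
pose Q := 2 * (`|p| + 1) + 1.
have Q0 : 0 < Q by rewrite ltr_wpDl // mulr_ge0 // addr_ge0.
pose C := 4 * `|v| * Q + 8 * `|v| ^+ 2 * `|L0|.
have C0 : 0 <= C by rewrite addr_ge0 // !mulr_ge0 ?exprn_ge0 // ltW.
pose e := Num.min (Num.min (`|v| / (8 * Q)) (rho' / (2 * `|v|)))
  (Num.min (tau / 2) (eta / (tau * C + 1))).
have tC : 0 < tau * C + 1 by rewrite ltr_wpDl // mulr_ge0 // ltW.
have e0 : 0 < e by rewrite !lt_min !divr_gt0 // !mulr_gt0.
have eQ : e * (8 * Q) <= `|v|.
  by rewrite -ler_pdivlMr ?mulr_gt0 // !ge_min lexx.
have erho : e * (2 * `|v|) <= rho'.
  by rewrite -ler_pdivlMr ?mulr_gt0 // !ge_min lexx orbT.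
have etau : e <= tau / 2 by rewrite !ge_min lexx !orbT.
have eeta : e * (tau * C + 1) <= eta.
  by rewrite -ler_pdivlMr // !ge_min lexx !orbT.
have [n [L [b [/andP[n0 ne] hL hb stay]]]] := inv e e0.
have closeV x : `|x - p| < r -> `|fld L0 b0 x - v| <= `|v| / 8.
  move=> xp; rewrite /v /fld opprD addrACA subrr addr0 -mulmxBl.
  apply: le_trans (mulmx_norm _ _) _; have := normr_ge0 L0.
  by have := normr_ge0 (x - p); nra.
have closeX x : `|x - p| < r -> `|fld L b x - fld L0 b0 x| <= e * Q.
  move=> xp; rewrite fld_sub; apply: le_trans (fld_norm _ _ _) _.
  have xP : `|x| <= `|p| + 1.
    by have := ler_normD (x - p) p; rewrite subrK; lra.
  by rewrite /Q; have := normr_ge0 x; have := normr_ge0 (L - L0); nra.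
have close x : `|x - p| < r -> `|fld L b x - v| <= `|v| / 4.
  move=> xp; have := ler_normD (fld L b x - fld L0 b0 x) (fld L0 b0 x - v).
  by rewrite addrA subrK; have := closeX x xp; have := closeV x xp; lra.
pose K := Num.truncn (tau / n).
have /andP[K1 K2] : K%:R * n <= tau < K%:R * n + n.
  have := truncn_itv (divr_ge0 (ltW tau0) (ltW n0)).
  by rewrite -/K -natr1 ler_pdivlMr // ltr_pdivrMr // mulrDl mul1r.
have [|s [s0 orb]] := @euler_orbit (fld L b) v t0 n r K t001 n0 r0 inmid close stay.
  by rewrite -tauv; nra.
exists s, K; split => //.
- have incr k : (k < K)%N -> `|ham L0 b0 (G (s k.+1)) - ham L0 b0 (G (s k))| <=
      n * (e * C).
    move=> kK; have [_ xp _ ->] := orb k (ltnW kK); last by [].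
    rewrite ham_flow // normrM (gtr0_norm n0) ler_wpM2l ?(ltW n0) //.
    set x := G (s k) in xp *; set y := fld L b x.
    have y2 : `|y| <= 2 * `|v|.
      by have := ler_normD (y - v) v; rewrite subrK; have := close x xp; lra.
    have x2 : `|fld L0 b0 x| <= 2 * `|v|.
      by have := ler_normD (fld L0 b0 x - v) v; rewrite subrK;
         have := closeV x xp; lra.
    apply: le_trans (ler_normD _ _) _; rewrite /C mulrDr lerD //.
      apply: le_trans (omega_norm _ _) _.
      have := closeX x xp; rewrite -/y => h; have h0 := normr_ge0 (fld L0 b0 x).
      have h1 := normr_ge0 (y - fld L0 b0 x).
      have : `|fld L0 b0 x| * `|y - fld L0 b0 x| <= (2 * `|v|) * (e * Q).
        by rewrite ler_pM.
      by lra.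
    rewrite normrM (gtr0_norm n0) ler_pM // ?(ltW n0) ?(ltW ne) //.
    rewrite normrM (ger0_norm (_ : 0 <= 2^-1)) ?invr_ge0 //.
    have h1 := omega_norm (y *m L0) y.
    have : `|y *m L0| * `|y| <= (2 * `|y| * `|L0|) * `|y|.
      by rewrite ler_wpM2r // mulmx_norm.
    have : (`|y| * `|y|) * `|L0| <= (2 * `|v| * (2 * `|v|)) * `|L0|.
      by rewrite ler_wpM2r // ler_pM.
    by lra.
  have drift k : (k <= K)%N ->
      `|ham L0 b0 (G (s k)) - ham L0 b0 (G t0)| <= k%:R * (n * (e * C)).
    elim: k => [|k IH] kK; first by rewrite s0 subrr normr0 mul0r.
    have := ler_normD (ham L0 b0 (G (s k.+1)) - ham L0 b0 (G (s k)))
              (ham L0 b0 (G (s k)) - ham L0 b0 (G t0)).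
    rewrite addrA subrK -natr1 mulrDl mul1r.
    by have := IH (ltnW kK); have := incr k kK; lra.
  move=> k kK; have [k01 _ _ _] := orb k kK; split => //.
  apply: le_trans (drift k kK) _.
  have kn : k%:R * n <= tau.
    by apply: le_trans K1; rewrite ler_wpM2r ?ler_nat // ltW.
  have : k%:R * n * (e * C) <= tau * (e * C).
    by rewrite ler_wpM2r // mulr_ge0 // ltW.
  by lra.
- move=> k kK; have [k01 xp _ ek] := orb k (ltnW kK).
  have [k101 _ _ _] := orb k.+1 kK.
  apply: Hrho' => //; rewrite ek // addrAC subrr add0r normrZ (gtr0_norm n0).
  have y2 : `|fld L b (G (s k))| <= 2 * `|v|.
    by have := ler_normD (fld L b (G (s k)) - v) v; rewrite subrK;
       have := close _ xp; lra.
  by have := normr_ge0 (fld L b (G (s k))); nra.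
- have [K01 _ far _] := orb K (leqnn K).
  rewrite leNgt; apply/negP => h.
  have := Hzeta _ _ K01 t001 h; rewrite -/p.
  have := ler_normB (G (s K) - p) (G (s K) - p - (K%:R * n) *: v).
  rewrite opprB addrC subrK normrZ ger0_norm; last first.
    by rewrite mulr_ge0 // ltW.
  have : tau / 2 * `|v| <= K%:R * n * `|v| by rewrite ler_wpM2r //; lra.
  move: far; rewrite -/p; lra.
Qed.

End ArcFlow.

Section ArcHam.
Context (R : realType) (G : R -> 'rV[R]_2).
Hypothesis cG : continuous G.
Hypothesis iG : forall s t, in01 s -> in01 t -> G s = G t -> s = t.

Lemma ham_continuous (L : 'M[R]_2) (b : 'rV[R]_2) :
  continuous (fun t => ham L b (G t)).
Proof.
have c0 := continuous_coord (j := 0) cG; have c1 := continuous_coord (j := 1) cG.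
rewrite (_ : (fun t => _) = (fun t =>
    ((G t 0 0 * L 0 0 + G t 0 1 * L 1 0) * G t 0 1 -
     (G t 0 0 * L 0 1 + G t 0 1 * L 1 1) * G t 0 0) / 2 +
    (b 0 0 * G t 0 1 - b 0 1 * G t 0 0))); last first.
  by apply: funext => t; rewrite /ham /omega !mulmx2E.
move=> t; apply: cvgD; last by apply: cvgB; apply: cvgMr; [exact: c1 | exact: c0].
apply: cvgMl; apply: cvgB; apply: cvgM; first [exact: c0 | exact: c1 | idtac];
  by apply: cvgD; apply: cvgMl; [exact: c0 | exact: c1].
Qed.

(** The orbits of the previous lemma fill one of the two subarcs adjacent to
    their origin with arbitrary precision, and the Hamiltonian is continuous.
    The side may depend on the precision, hence the argument by contradiction
    with one bad parameter on each side. *)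
Lemma ham_constant (L0 : 'M[R]_2) (b0 : 'rV[R]_2) (t0 : R) :
  \tr L0 = 0 -> 1 / 4 < t0 < 3 / 4 -> fld L0 b0 (G t0) != 0 ->
  almost_invariant G L0 b0 ->
  exists T0 T1, [/\ in01 T0, in01 T1, T0 < T1 &
    forall t, T0 <= t <= T1 -> ham L0 b0 (G t) = ham L0 b0 (G t0)].
Proof.
move=> trL t0mid v0 inv.
have [zeta zeta0 dense] := dense_orbits cG iG trL t0mid v0 inv.
pose z := Num.min zeta (1 / 4).
have z0 : 0 < z by rewrite lt_min zeta0; lra.
have zz : z <= zeta by rewrite ge_min lexx.
have z4 : z <= 1 / 4 by rewrite ge_min lexx orbT.
apply: contrapT => none.
have [tp [tpz hp]] : exists tp, t0 <= tp <= t0 + z /\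
    ham L0 b0 (G tp) != ham L0 b0 (G t0).
  apply: contrapT => h; apply: none; exists t0, (t0 + z).
  split; rewrite /in01; [lra | lra | lra |] => t tz.
  by apply/eqP/negPn/negP => e; apply: h; exists t.
have [tm [tmz hm]] : exists tm, t0 - z <= tm <= t0 /\
    ham L0 b0 (G tm) != ham L0 b0 (G t0).
  apply: contrapT => h; apply: none; exists (t0 - z), t0.
  split; rewrite /in01; [lra | lra | lra |] => t tz.
  by apply/eqP/negPn/negP => e; apply: h; exists t.
pose del := Num.min `|ham L0 b0 (G tp) - ham L0 b0 (G t0)|
                    `|ham L0 b0 (G tm) - ham L0 b0 (G t0)|.
have del0 : 0 < del by rewrite lt_min !normr_gt0 !subr_eq0 hp hm.
have del2 : 0 < del / 2 by rewrite divr_gt0.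
have [rho rho0 Hrho] := param_modulus (fun t => @cvg_id _ (nbhs t))
  (@ham_continuous L0 b0) del2
  (fun s t _ _ => @congr1 _ _ (fun t => ham L0 b0 (G t)) s t).
pose eta := Num.min rho (del / 2).
have eta0 : 0 < eta by rewrite lt_min rho0.
have etarho : eta <= rho by rewrite ge_min lexx.
have [s [K [s0 sh step far]]] := dense eta eta0.
have reach t k : in01 t -> (k <= K)%N -> `|t - s k| < eta ->
    `|ham L0 b0 (G t) - ham L0 b0 (G t0)| < del.
  move=> t01 kK h; have [k01 hk] := sh k kK.
  have h1 := Hrho t (s k) t01 k01 (lt_le_trans h etarho).
  have := ler_normD (ham L0 b0 (G t) - ham L0 b0 (G (s k)))
            (ham L0 b0 (G (s k)) - ham L0 b0 (G t0)).
  rewrite addrA subrK; have : eta <= del / 2 by rewrite ge_min lexx orbT.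
  by lra.
move: far; rewrite ler_normr => /orP[far|far].
  have [|k kK hk] := discrete_crossing (t := tp) eta0 _ step.
    by rewrite s0; lra.
  have := reach tp k _ kK hk; rewrite lt_min ltxx /= => h.
  by apply/notF/h; rewrite /in01; lra.
have [||k kK hk] := @discrete_crossing _ (fun k => - s k) K (- tm) _ eta0.
- by rewrite s0; lra.
- by move=> k kK; rewrite -opprD normrN step.
rewrite -opprD normrN in hk.
have := reach tm k _ kK hk; rewrite lt_min ltxx andbF => h.
by apply/notF/h; rewrite /in01; lra.
Qed.

End ArcHam.

(** * Compactness of bounded families of affine fields *)

Lemma unit_ball_compact (R : realType) n : compact [set v : 'rV[R]_n | `|v| <= 1].
Proof.
apply: bounded_closed_compact.
  by exists 1; split => // x x1 v /= v1; rewrite (le_trans v1) // ltW.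
apply: (preimage_closed (f := fun v : 'rV[R]_n => `|v|) _ (@closed_le R 1)) => v _.
exact: norm_continuous.
Qed.

(** The conditions [P e] form a filter base on the unit ball of the six
    dimensional space of affine fields, which is compact. *)
Lemma fields_cluster (R : realType) (P : R -> 'M[R]_2 -> 'rV[R]_2 -> Prop) :
  (forall e e' L b, e <= e' -> P e L b -> P e' L b) ->
  (forall e, 0 < e -> exists L b, [/\ P e L b, `|L| <= 1 & `|b| <= 1]) ->
  exists L0 b0, forall e, 0 < e -> exists L b,
    [/\ P e L b, `|L - L0| < e & `|b - b0| < e].
Proof.
move=> Pmono Pne.
pose mat (v : 'rV[R]_(2 * 2 + 2)) : 'M[R]_2 := vec_mx (lsubmx v).
pose vec (v : 'rV[R]_(2 * 2 + 2)) : 'rV[R]_2 := rsubmx v.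
have matn v : `|mat v| <= `|v|.
  by apply: norm_entries => // i j; rewrite !mxE entry_norm.
have vecn v : `|vec v| <= `|v|.
  by apply: norm_entries => // i j; rewrite !mxE entry_norm.
pose F (U : set 'rV[R]_(2 * 2 + 2)) := exists2 e, 0 < e &
  forall v, `|v| <= 1 -> P e (mat v) (vec v) -> U v.
have FF : ProperFilter F.
  split.
    case=> e e0 /= h; have [L [b [Pe L1 b1]]] := Pne e e0.
    apply: (h (row_mx (mxvec L) b));
      rewrite /mat /vec ?row_mxKl ?row_mxKr ?mxvecK //.
    apply: (@norm_entries _ 1 (2 * 2 + 2)) => // i j; rewrite -(splitK j) /=.
    case: (fintype.split j) => k /=; rewrite ?row_mxEl ?row_mxEr; last first.
      by rewrite (le_trans _ b1) // entry_norm.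
    case/mxvec_indexP: k => k l.
    by rewrite (ord1 i) mxvecE (le_trans _ L1) // entry_norm.
  split; first by exists 1.
    move=> U V [e e0 hU] [d d0 hV].
    exists (Num.min e d); first by rewrite lt_min e0.
    move=> v v1 Pv; split; [apply: hU => //|apply: hV => //].
      by apply: Pmono Pv; rewrite ge_min lexx.
    by apply: Pmono Pv; rewrite ge_min lexx orbT.
  by move=> U V UV [e e0 hU]; exists e => // v v1 /(hU _ v1) /UV.
have [|v0 [_ cl]] := @unit_ball_compact R (2 * 2 + 2) F FF; first by exists 1.
exists (mat v0), (vec v0) => e e0.
have [|v [[v1 Pv] vv0]] := cl [set v | `|v| <= 1 /\ P e (mat v) (vec v)] _ _
  (nbhsx_ballx v0 e e0).
  by exists e.
move: vv0; rewrite -ball_normE /= distrC => vv0.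
exists (mat v), (vec v); split => //.
  apply: le_lt_trans vv0; rewrite (_ : mat v - mat v0 = mat (v - v0)) //.
  by apply/matrixP => i j; rewrite !mxE.
apply: le_lt_trans vv0; rewrite (_ : vec v - vec v0 = vec (v - v0)) //.
by apply/matrixP => i j; rewrite !mxE.
Qed.

(** The sequence is rescaled into the unit ball, and the condition attached to
    [e] is to be a term of index at least [1 / e]; a cluster point of these
    conditions is a cluster point of the sequence. *)
Lemma close_pair (R : realType) (h : nat -> 'M[R]_2 * 'rV[R]_2) (C eps : R) :
  0 < C -> (forall n, `|(h n).1| <= C /\ `|(h n).2| <= C) -> 0 < eps ->
  exists n n', [/\ n != n', `|(h n').1 - (h n).1| < eps &
    `|(h n').2 - (h n).2| < eps].
Proof.
move=> C0 bound eps0.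
pose P (e : R) (L : 'M[R]_2) (b : 'rV[R]_2) :=
  exists n, [/\ 1 <= e * n%:R, L = C^-1 *: (h n).1 &
  b = C^-1 *: (h n).2].
have [||L0 [b0 acc]] := @fields_cluster R P.
- move=> e e' L b ee' [n [en -> ->]]; exists n; split => //.
  by apply: le_trans en _; rewrite ler_wpM2r.
- move=> e e0; pose n := (Num.truncn e^-1).+1.
  have [h1 h2] := bound n.
  exists (C^-1 *: (h n).1), (C^-1 *: (h n).2); split.
  + exists n; split => //; rewrite mulrC -ler_pdivrMr // div1r.
    have := truncn_itv (ltW (_ : 0 < e^-1)); rewrite invr_gt0 => /(_ e0).
    by case/andP => _ /ltW.
  + by rewrite normrZ gtr0_norm ?invr_gt0 // mulrC ler_pdivrMr // mul1r.
  + by rewrite normrZ gtr0_norm ?invr_gt0 // mulrC ler_pdivrMr // mul1r.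
pose d := eps / (2 * C).
have d0 : 0 < d by rewrite divr_gt0 // mulr_gt0.
have [_ [_ [[n [_ -> ->]] n1 n2]]] := acc d d0.
pose d' := Num.min d n.+1%:R^-1.
have d'0 : 0 < d' by rewrite lt_min d0 invr_gt0 ltr0Sn.
have [_ [_ [[n' [en' -> ->]] n'1 n'2]]] := acc d' d'0.
have d'd : d' <= d by rewrite ge_min lexx.
have nn' : (n < n')%N.
  rewrite -(ler_nat R) -[leLHS]mulr1 -ler_pdivlMl //; apply: le_trans en' _.
  by rewrite ler_wpM2r // ge_min lexx orbT.
have key (V : normedModType R) (x y z : V) : `|C^-1 *: x - z| < d ->
    `|C^-1 *: y - z| < d' -> `|y - x| < eps.
  move=> hx hy; have -> : y - x = C *: (C^-1 *: y - z - (C^-1 *: x - z)).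
    rewrite opprB addrA subrK -scalerBr scalerA mulfV ?scale1r //.
    by rewrite gt_eqF.
  rewrite normrZ gtr0_norm //.
  have -> : eps = C * (d + d) by rewrite /d; field; rewrite gt_eqF.
  rewrite ltr_pM2l //; apply: le_lt_trans (ler_normB _ _) _.
  by apply: ltrD => //; apply: lt_le_trans d'd.
exists n, n'; split; first by rewrite neq_ltn nn'.
- exact: key n1 n'1.
- exact: key n2 n'2.
Qed.

(** Otherwise every alternative would fail below some scale, and all of them
    would fail below the smallest of these scales. *)
Lemma finite_pigeonhole (R : realType) (I : finType) (P : I -> R -> Prop) :
  (forall i e e', e <= e' -> P i e -> P i e') ->
  (forall e, 0 < e -> exists i, P i e) -> exists i, forall e, 0 < e -> P i e.
Proof.
move=> mono all; apply: contrapT => none.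
have /choice[g gP] : forall i, exists e, 0 < e /\ ~ P i e.
  move=> i; apply: contrapT => h; apply: none; exists i => e e0.
  by apply: contrapT => np; apply: h; exists e.
pose d := \big[Num.min/1]_i g i.
have d0 : 0 < d by apply/bigmin_gtP; split => // i _; case: (gP i).
have [i Pi] := all d d0; case: (gP i) => _; apply.
by apply: mono Pi; exact: bigmin_le.
Qed.

Lemma count_lt (T : eqType) (a b : pred T) (s : seq T) r : r \in s -> b r ->
  (forall t, a t -> b t && (t != r)) -> (count a s < count b s)%N.
Proof.
move=> + br ab; elim: s => //= h s IH; rewrite inE => /orP[/eqP <-|rs].
  have -> : a r = false by apply/negP => /ab; rewrite eqxx andbF.
  by rewrite br add0n add1n ltnS; apply: sub_count => t /ab/andP[].
rewrite -addnS leq_add ?IH //.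
by case ah : (a h) => //; have /andP[-> _] := ab _ ah.
Qed.

Lemma finite_gap (R : realType) (A : set R) (c : R) : finite_set A ->
  exists2 eta, 0 < eta & forall d, A d -> d != c -> eta <= `|d - c|.
Proof.
move=> /finite_seqP[s ->]; elim: s => [|a s [eta eta0 IH]]; first by exists 1.
exists (if a == c then eta else Num.min eta `|a - c|).
  by case: eqVneq => // ac; rewrite lt_min eta0 normr_gt0 subr_eq0.
move=> d /=; rewrite inE => /orP[/eqP ->|ds] dc.
  by rewrite (negPf dc) ge_min lexx orbT.
case: eqVneq => ac; first exact: IH.
by rewrite ge_min IH.
Qed.

(** * Cutting an arc into finitely many types of pieces *)

Section Pieces.
Context (R : realType) (m : nat) (sw : seq 'I_m -> R -> R).
Implicit Types (e f : bool) (x y d a b : R) (u v w : seq 'I_m).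

(** The cells [w] and [v] overlap between the end [e] of [w] and the end [e'] of
    [v]; each of these ends has a position, [y] and [x], in the other cell.
    Rigidity says that only finitely many positions occur when the overlap is a
    definite portion of both cells. *)
Definition rigid := forall (e e' : bool) (delta : R), 0 < delta ->
  finite_set [set x | in01 x /\ exists w v y,
    [/\ in01 y, sw w x = sw v e'%:R, sw w e%:R = sw v y,
        delta <= `|x - e%:R| & delta <= `|y - e'%:R| ]].

Hypothesis sw_in01 : forall w x, in01 x -> in01 (sw w x).
Hypothesis sw_btw : forall w x y z, in01 x -> in01 y -> in01 z ->
  btw (sw w x) (sw w y) (sw w z) = btw x y z.
Hypothesis sw_ivt : forall w x y z, in01 x -> in01 y ->
  btw (sw w x) (sw w y) z -> exists2 t, btw x y t & sw w t = z.
Hypothesis sw_nil : forall x, in01 x -> sw [::] x = x.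
Hypothesis sw_cat : forall u v x, in01 x -> sw (u ++ v) x = sw u (sw v x).
Hypothesis sw_mesh : forall eta, 0 < eta -> exists n, forall w, (n <= size w)%N ->
  `|sw w 0 - sw w 1| < eta.
Hypothesis sw_cover : forall x, in01 x ->
  exists i, exists2 t, in01 t & x = sw [:: i] t.
Hypothesis sw_rigid : rigid.

Lemma in01_bool e : in01 (e%:R : R).
Proof. by case: e; [exact: in01_1 | exact: in01_0]. Qed.
Hint Resolve in01_bool : core.

Lemma sw_inj w x y : in01 x -> in01 y -> sw w x = sw w y -> x = y.
Proof.
move=> x01 y01 e; apply/esym/btw_eq.
by rewrite -(sw_btw w) // e btwl.
Qed.

Definition cell w x := btw (sw w 0) (sw w 1) x.

Lemma cell_sw w x : in01 x -> cell w (sw w x).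
Proof.
move=> x01; rewrite /cell sw_btw ?in01_0 ?in01_1 //.
by move: x01; rewrite /in01 /btw => ->.
Qed.

Lemma cellP w x : cell w x -> exists2 t, in01 t & x = sw w t.
Proof.
move=> /sw_ivt [||t t01 <-]; rewrite ?in01_0 ?in01_1 //.
by exists t => //; apply: btw_in01 t01; rewrite ?in01_0 ?in01_1.
Qed.

Lemma cell_nil x : in01 x -> cell [::] x.
Proof. by move=> x01; rewrite -[x]sw_nil //; exact: cell_sw. Qed.

Lemma cell_btw w x y z : cell w x -> cell w y -> btw x y z -> cell w z.
Proof. exact: btw_trans. Qed.

Lemma cell_catP w u x : in01 x -> cell (w ++ u) (sw w x) = cell u x.
Proof.
move=> x01; rewrite /cell !sw_cat ?in01_0 ?in01_1 // sw_btw // sw_in01 //.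
  exact: in01_0.
exact: in01_1.
Qed.

Lemma cell_dist w x y : cell w x -> cell w y -> `|x - y| <= `|sw w 0 - sw w 1|.
Proof.
rewrite /cell /btw => h1 h2; rewrite ler_norml; apply/andP.
by split; case: (lerP (sw w 0) (sw w 1)); lra.
Qed.

Lemma cell_bool w e x : cell w x = btw (sw w e%:R) (sw w (~~ e)%:R) x.
Proof. by case: e => //=; rewrite btwC. Qed.

Lemma separate x y : x != y ->
  exists n, forall w, (n <= size w)%N -> ~ (cell w x /\ cell w y).
Proof.
move=> xy; have [|n nP] := @sw_mesh `|x - y|; first by rewrite normr_gt0 subr_eq0.
exists n => w /nP h [cx cy]; have := cell_dist cx cy.
by rewrite leNgt h.
Qed.

(** The cell [v] covers the part of the cell [w] from the cut point [sw v e'] to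
    the end [e]; restricted to such positions, rigidity applies after zooming
    at the two ends of the overlap. *)
Definition position e x := in01 x /\ exists w v e',
  sw w x = sw v e'%:R /\ cell v (sw w e%:R).

Lemma position_side e x u y f : position e x -> in01 y -> x = sw u y ->
  btw x e%:R (sw u f%:R) -> position f y.
Proof.
move=> [x01 [w [v [e' [xE ve]]]]] y01 xu hf; split => //.
exists (w ++ u), v, e'; rewrite !sw_cat // -xu; split => //.
apply: (cell_btw _ ve (_ : btw (sw w x) _ _)).
  by rewrite xE; exact: cell_sw.
by rewrite sw_btw // sw_in01.
Qed.

(** The part of the smaller cell towards [e] is still covered by [v]. *)
Lemma position_pull e x u y : position e x -> in01 y -> x = sw u y ->
  exists f, position f y.
Proof.
move=> px y01 xu; have := cell_sw u y01; rewrite -xu => cx.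
have [x01 _] := px.
have h0 := sw_in01 u (in01_0 R); have h1 := sw_in01 u (in01_1 R).
have /orP[h|h] : btw x e%:R (sw u 0) || btw x e%:R (sw u 1).
- move: cx h0 h1 x01; rewrite /cell /btw /in01; case: e {px} => /=;
    by case: (lerP (sw u 0) x); case: (lerP (sw u 1) x); lra.
- by exists false; exact: (@position_side e x u y false).
- by exists true; exact: (@position_side e x u y true).
Qed.

(** Starting at one of its ends, [v] is long enough to reach past [w] on one
    side. *)
Lemma position_short w v e x : in01 x -> sw w x = sw v e%:R ->
  `|sw w 0 - sw w 1| <= `|sw v 0 - sw v 1| -> exists f, position f x.
Proof.
move=> x01 xE short; have cx := cell_sw w x01.
have /orP[h|h] : cell v (sw w 0) || cell v (sw w 1).
- move: cx short; rewrite xE /cell /btw; case: e {xE} => /=;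
    by case: (lerP (sw w 0) (sw w 1)); case: (lerP (sw v 0) (sw v 1)); lra.
- by exists false; split => //; exists w, v, e.
- by exists true; split => //; exists w, v, e.
Qed.

Lemma sw_end w e t : in01 t -> sw w t = e%:R -> exists f : bool, t = f%:R.
Proof.
move=> t01 tE; have := cell_sw w t01.
have h0 := sw_in01 w (in01_0 R); have h1 := sw_in01 w (in01_1 R).
rewrite /cell tE => c.
have [h|h] : sw w 0 = e%:R \/ sw w 1 = e%:R.
  by move: c h0 h1; rewrite /btw /in01; case: e {tE} => /=;
    case: (ltrgtP (sw w 0) (sw w 1)); lra.
- by exists false; apply: (@sw_inj w); rewrite ?in01_0 // h.
- by exists true; apply: (@sw_inj w); rewrite ?in01_1 // h.
Qed.

Lemma deep_cell n x : in01 x -> exists2 w, size w = n & cell w x.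
Proof.
elim: n x => [|n IH] x x01; first by exists [::] => //; exact: cell_nil.
have [i [t t01 ->]] := sw_cover x01; have [w sz ct] := IH t t01.
by exists (i :: w); rewrite /= ?sz // -[i :: w]/([:: i] ++ w) cell_catP.
Qed.

(** ** The end cells and the finite set of types *)

Definition cell_end x := exists i f, x = sw [:: i] f%:R.

(** These positions arise when a piece is cut at an end of a cell of the first
    generation and then read in another such cell. *)
Definition overlap_end x := in01 x /\ exists i, cell_end (sw [:: i] x).

Lemma cell_end_in01 x : cell_end x -> in01 x.
Proof. by case=> i [f ->]; exact: sw_in01. Qed.

Lemma overlap_bool e : overlap_end e%:R.
Proof.
split=> //; have [i _] := sw_cover (in01_bool e).
by exists i, i, e.
Qed.

Lemma finite_pull (A : set R) u : finite_set A ->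
  finite_set [set x | in01 x /\ A (sw u x)].
Proof.
move=> fA.
pose g x := if in01 x then Some (sw u x) else None.
apply: (@sub_finite_set _ _ (g @^-1` (Some @` A))) => [x [x01 Ax]|].
  by rewrite /g /= x01; exists (sw u x).
apply: finite_preimage; last exact: finite_image.
move=> x y; rewrite !inE /g /=; case: ifP => [x01|_]; last by case.
by case: ifP => [y01|_ _]; [move=> _ _ [] /sw_inj; apply | case].
Qed.

Lemma finite_cell_end : finite_set cell_end.
Proof.
apply: (@sub_finite_set _ _ (range (fun p : 'I_m * bool => sw [:: p.1] p.2%:R))).
  by move=> x [i [f ->]]; exists (i, f).
exact: finite_image.
Qed.

Lemma finite_overlap : finite_set overlap_end.
Proof.
apply: (@sub_finite_set _ _ (\bigcup_(i in [set: 'I_m])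
    [set x | in01 x /\ cell_end (sw [:: i] x)])).
  by move=> x [x01 [i h]]; exists i.
apply: bigcup_finite => // i _; apply: finite_pull; exact: finite_cell_end.
Qed.

(** Deep cells at the ends are too short to contain another point of the finite
    set of overlap ends. Words need not fix an end of the arc, whence [tau]. *)
Lemma end_cells_exist : exists (z : bool -> seq 'I_m) (tau : bool -> bool),
  [/\ forall e, (0 < size (z e))%N, forall e, sw (z e) (tau e)%:R = e%:R &
    forall e d, overlap_end d -> cell (z e) d -> d = e%:R].
Proof.
suff /choice[g gP] : forall e, exists p : seq 'I_m * bool,
    [/\ (0 < size p.1)%N, sw p.1 p.2%:R = e%:R &
      forall d, overlap_end d -> cell p.1 d -> d = e%:R].
  exists (fun e => (g e).1), (fun e => (g e).2).
  by split=> [e|e|e d]; case: (gP e) => // _ _; apply.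
move=> e; have [eta eta0 gap] := finite_gap e%:R finite_overlap.
have [n nP] := sw_mesh eta0.
have [w sz cw] := deep_cell (maxn n 1) (in01_bool e).
have [t t01 tE] := cellP cw; have [f fE] := sw_end t01 (esym tE).
exists (w, f); split; rewrite /= -?fE //; first by rewrite sz leq_max orbT.
move=> d dD cd; apply/eqP/negPn/negP => de; have := gap d dD de.
rewrite leNgt; apply/negP/negPn; apply: le_lt_trans (cell_dist cd cw) _.
by apply: nP; rewrite sz leq_maxl.
Qed.

Variables (z : bool -> seq 'I_m) (tau : bool -> bool).

Definition inner_end e := sw (z e) (~~ tau e)%:R.

Hypothesis z_size : forall e, (0 < size (z e))%N.
Hypothesis z_end : forall e, sw (z e) (tau e)%:R = e%:R.
Hypothesis z_avoids : forall e d, overlap_end d -> cell (z e) d -> d = e%:R.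

Definition seed x := [\/ overlap_end x, cell_end x | exists e, x = inner_end e].

(** Cutting is to be repeated inside subcells, so the positions of the seeds in
    these are needed as well; [N] generations are enough because later these
    positions satisfy [position]. *)
Definition seed_pull N x := in01 x /\ exists2 u, (size u <= N)%N & seed (sw u x).

Definition far e x := position e x /\ ~ cell (z e) x.

Lemma cell_zE e x : cell (z e) x = btw e%:R (inner_end e) x.
Proof. by rewrite (cell_bool _ (tau e)) z_end. Qed.

Lemma seed_in01 x : seed x -> in01 x.
Proof.
case=> [[]//|/cell_end_in01//|[e ->]].
exact: sw_in01.
Qed.

Lemma inner_neq e : inner_end e != e%:R.
Proof.
apply/eqP; rewrite -[RHS]z_end => /sw_inj -/(_ (in01_bool _) (in01_bool _)).
by case: (tau e) => /eqP; rewrite ?(eq_sym 0) oner_eq0.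
Qed.

Lemma finite_seed : finite_set seed.
Proof.
apply: (@sub_finite_set _ _ (overlap_end `|` cell_end `|` range inner_end)).
  by move=> x [h|h|[e ->]]; [left; left|left; right|right; exists e].
rewrite !finite_setU; split.
  by split; [exact: finite_overlap | exact: finite_cell_end].
exact: finite_image.
Qed.

Lemma finite_seed_pull N : finite_set (seed_pull N).
Proof.
apply: (@sub_finite_set _ _ (\bigcup_(u in [set: N.-bseq 'I_m])
    [set x | in01 x /\ seed (sw u x)])).
  by move=> x [x01 [u uN sx]]; exists (Bseq uN).
by apply: bigcup_finite => // u _; apply: finite_pull; exact: finite_seed.
Qed.

(** Passing repeatedly from [v] to its end cell at [a] shrinks it to [a], so [b]
    is lost at some stage; just before, [b] lies in the definite portion of the
    cell outside the end cell. *)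
Lemma zoom_end a b v e : a != b -> sw v e%:R = a -> cell v b ->
  exists v' e', [/\ sw v' e'%:R = a, cell v' b & ~ cell (v' ++ z e') b].
Proof.
move=> ab va vb; have [n nP] := separate ab.
have {}nP : forall u, (n <= size u)%N -> ~ (cell (v ++ u) a /\ cell (v ++ u) b).
  by move=> u nu; apply: nP; rewrite size_cat (leq_trans nu) // leq_addl.
elim: n v e va vb nP => [|n IH] v e va vb nP.
  by case: (nP [::]); rewrite // cats0 -{1}va; split => //; exact: cell_sw.
case: (pselect (cell (v ++ z e) b)) => h; last by exists v, e.
apply: (IH (v ++ z e) (tau e)) => //; first by rewrite sw_cat // z_end.
move=> u nu; rewrite -catA; apply: nP; rewrite size_cat.
have := z_size e; case: (size (z e)) => // k _.
by rewrite addSn ltnS (leq_trans nu) // leq_addl.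
Qed.

Lemma not_cell_z_dist e x : in01 x -> ~ cell (z e) x ->
  `|inner_end e - e%:R| <= `|x - e%:R|.
Proof.
rewrite cell_zE => x01 /negP nx.
have := sw_in01 (z e) (in01_bool (~~ tau e)); rewrite -/(inner_end e) => q01.
case: (lerP `|inner_end e - e%:R| `|x - e%:R|) => // h; case/negP: nx.
move: x01 q01 h; rewrite /btw /in01; case: e => /=.
  by case: (lerP (inner_end true) 1); case: (lerP x 1); lra.
by case: (lerP (inner_end false) 0); case: (lerP x 0); lra.
Qed.

(** Outside the end cell the overlap is a definite portion of the cell in which
    the position is taken; zooming makes it a definite portion of the other
    cell as well, and rigidity applies. *)
Lemma finite_far e : finite_set (far e).
Proof.
pose delta := Num.min `|inner_end true - true%:R| `|inner_end false - false%:R|.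
have delta0 : 0 < delta by rewrite lt_min !normr_gt0 !subr_eq0 !inner_neq.
have deltaP f : delta <= `|inner_end f - f%:R|.
  by case: f; rewrite /delta ge_min lexx ?orbT.
apply: (@sub_finite_set _ _ (\bigcup_(e' in [set: bool])
  [set x | in01 x /\ exists w v y,
    [/\ in01 y, sw w x = sw v e'%:R, sw w e%:R = sw v y,
        delta <= `|x - e%:R| & delta <= `|y - e'%:R| ]])); last first.
  by apply: bigcup_finite => // e' _; exact: sw_rigid.
move=> x [[x01 [w [v [e' [xE ve]]]]] nx].
have xe : sw w x != sw w e%:R.
  apply/eqP => /sw_inj h; apply: nx; rewrite h // cell_zE; exact: btwl.
have [v' [f [fE cf nf]]] := zoom_end xe (esym xE) ve.
have [y y01 yE] := cellP cf.
exists f => //; split => //; exists w, v', y; split => //.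
  by apply: le_trans (deltaP e) _; exact: not_cell_z_dist.
apply: le_trans (deltaP f) _; apply: not_cell_z_dist => // cy.
by apply: nf; rewrite yE cell_catP.
Qed.

(** Deep cells are shorter than the finitely many cells whose ends are seeds. *)
Lemma deep_seed_position : exists N, forall u x, (N <= size u)%N -> in01 x ->
  seed (sw u x) -> exists f, position f x.
Proof.
pose shorter (v : seq 'I_m) n := forall w, (n <= size w)%N ->
  `|sw w 0 - sw w 1| <= `|sw v 0 - sw v 1|.
have ex v : exists n, shorter v n.
  have [|n nP] := @sw_mesh `|sw v 0 - sw v 1|.
    rewrite normr_gt0 subr_eq0; apply/eqP => /sw_inj.
    move=> /(_ (in01_0 R) (in01_1 R)) /eqP.
    by rewrite eq_sym oner_eq0.
  by exists n => w /nP /ltW.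
have mono v n n' : (n <= n')%N -> shorter v n -> shorter v n'.
  by move=> nn' h w /(leq_trans nn') /h.
have [n1 n1P] : exists n, forall i, shorter [:: i] n.
  have /choice[g gP] := fun i : 'I_m => ex [:: i].
  exists (\max_i g i) => i; apply: mono (gP i).
  exact: leq_bigmax.
have [n2 n2P] := ex (z true); have [n3 n3P] := ex (z false).
exists (maxn n1 (maxn n2 n3)) => u x; rewrite !geq_max => /and3P[h1 h2 h3] x01.
case=> [[_ [i [j [f fE]]]]|[j [f fE]]|[e eE]].
- apply: (@position_short ([:: i] ++ u) [:: j] f) => //; first by rewrite sw_cat.
  by apply: n1P; rewrite size_cat (leq_trans h1) // leq_addl.
- by apply: (@position_short u [:: j] f) => //; exact: n1P.
- apply: (@position_short u (z e) (~~ tau e)) => //.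
  by case: e {eE}; [exact: n2P | exact: n3P].
Qed.

(** ** Decomposition of arcs into pieces of finitely many types *)

Variable N : nat.
Hypothesis seedN : forall u x, (N <= size u)%N -> in01 x ->
  seed (sw u x) -> exists f, position f x.

(** The positions at which arcs are cut: unlike the finite set of ends of
    pieces, this set is stable under pulling back to subcells. *)
Definition cut x := (exists e, position e x) \/ seed_pull N x.

Definition type_end x := [\/ far true x, far false x | seed_pull N x].

Definition piece x y := [/\ type_end x, type_end y & x != y].

Inductive decomposed k : R -> R -> Prop :=
| decomposed_nil x : decomposed k x x
| decomposed_piece w x y : (k <= size w)%N -> piece x y ->
    decomposed k (sw w x) (sw w y)
| decomposed_cat x a y : btw x y a -> decomposed k x a -> decomposed k a y ->
    decomposed k x y.

Lemma seed_cut x : seed x -> seed_pull N x.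
Proof.
move=> sx; have x01 := seed_in01 sx; split => //.
by exists [::]; rewrite // sw_nil.
Qed.

Lemma type_end_in01 x : type_end x -> in01 x.
Proof. by case=> [[[]]|[[]]|[]]. Qed.

Lemma type_end_cut x : type_end x -> cut x.
Proof.
by case=> [[h _]|[h _]|h]; [left; exists true | left; exists false | right].
Qed.

Lemma cut_pull u x : in01 x -> cut (sw u x) -> cut x.
Proof.
move=> x01 [[e pe]|[_ [v vN sv]]].
  by left; apply: position_pull pe x01 _.
rewrite -sw_cat // in sv; case: (leqP (size (v ++ u)) N) => h.
  by right; split => //; exists (v ++ u).
by left; apply: seedN sv => //; exact: ltnW.
Qed.

Lemma decomposed_sym k x y : decomposed k x y -> decomposed k y x.
Proof.
elim=> {x y} [x|w x y kw [tx ty xy]|x a y h _ dax _ day].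
- exact: decomposed_nil.
- by apply: decomposed_piece => //; split; rewrite 1?eq_sym.
- by apply: decomposed_cat day dax; rewrite btwC.
Qed.

Lemma decomposed_map k u x y : in01 x -> in01 y -> decomposed k x y ->
  decomposed (size u + k) (sw u x) (sw u y).
Proof.
move=> + + d; elim: d => {x y} [x|w x y kw [tx ty xy]|x a y h _ dxa _ day] x01 y01.
- exact: decomposed_nil.
- rewrite -!sw_cat ?type_end_in01 //; apply: decomposed_piece => //.
  by rewrite size_cat leq_add2l.
- have a01 := btw_in01 x01 y01 h.
  by apply: decomposed_cat (dxa _ _) (day _ _) => //; rewrite sw_btw.
Qed.

Lemma decomposed_weak k l x y : (l <= k)%N -> decomposed k x y -> decomposed l x y.
Proof.
move=> lk; elim=> {x y} [x|w x y kw xy|x a y h _ d1 _ d2].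
- exact: decomposed_nil.
- by apply: decomposed_piece => //; exact: leq_trans kw.
- exact: decomposed_cat d1 d2.
Qed.

Lemma decomposed_types x y : type_end x -> type_end y -> decomposed 0 x y.
Proof.
move=> tx ty; case: (eqVneq x y) => [->|xy]; first exact: decomposed_nil.
have := type_end_in01 tx; have := type_end_in01 ty => y01 x01.
by rewrite -[x]sw_nil // -[y]sw_nil //; exact: decomposed_piece.
Qed.

(** Zooming into the end cell on the side of the overlap: each zoom splits off
    a piece of a fixed type, and the position leaves the end cell eventually. *)
Lemma decomposed_end n d e y : overlap_end d -> position e y ->
  (y = e%:R \/ forall u, (n <= size u)%N -> ~ (cell u e%:R /\ cell u y)) ->
  decomposed 0 d y.
Proof.
have tO x : overlap_end x -> type_end x.
  by move=> h; apply: Or33; apply: seed_cut; exact: Or31.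
elim: n d e y => [|n IH] d e y dD py [ye|ny].
- by rewrite ye; apply: decomposed_types; apply: tO => //; exact: overlap_bool.
- by have [y01 _] := py; case: (ny [::]) => //; split; exact: cell_nil.
- by rewrite ye; apply: decomposed_types; apply: tO => //; exact: overlap_bool.
case: (pselect (cell (z e) y)) => [cy|nc]; last first.
  apply: decomposed_types; first exact: tO.
  by case: e py nc {ny} => py nc; [exact: Or31 | exact: Or32].
have [y1 y101 yE] := cellP cy.
have py1 : position (tau e) y1.
  by apply: position_side py y101 yE _; rewrite z_end; exact: btwr.
have ny1 : y1 = (tau e)%:R \/
    forall u, (n <= size u)%N -> ~ (cell u (tau e)%:R /\ cell u y1).
  right=> u nu [c1 c2]; apply: (ny (z e ++ u)).
    rewrite size_cat; have := z_size e; case: (size (z e)) => // k _.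
    by rewrite addSn ltnS (leq_trans nu) // leq_addl.
  by rewrite yE -(z_end e) !cell_catP.
have step f : decomposed 0 (sw (z e) f%:R) y.
  rewrite yE; apply: (@decomposed_weak (size (z e) + 0)) => //.
  by apply: decomposed_map => //; exact: IH (overlap_bool f) py1 ny1.
case: (eqVneq d e%:R) => [->|de]; first by rewrite -z_end; exact: step.
have nd : ~ cell (z e) d by move=> /(z_avoids dD) h; rewrite h eqxx in de.
apply: (@decomposed_cat _ _ (inner_end e)); last exact: step.
- have [d01 _] := dD; have [y01 _] := py.
  have q01 : in01 (inner_end e) by exact: sw_in01.
  move: nd cy; rewrite !cell_zE => /negP.
  move: d01 y01 q01; rewrite /in01 /btw; case: (e) => /=; lra.
- apply: decomposed_types; first exact: tO.
  by apply: Or33; apply: seed_cut; apply: Or33; exists e.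
Qed.

Lemma decomposed_overlap d y : overlap_end d -> cut y -> decomposed 0 d y.
Proof.
move=> dD [[e py]|sy]; last first.
  apply: decomposed_types; last exact: Or33.
  by apply: Or33; apply: seed_cut; exact: Or31.
have [y01 _] := py; case: (eqVneq y e%:R) => [ye|ye].
  by apply: (@decomposed_end 0 d e) => //; left.
have [n nP] := separate ye.
by apply: (@decomposed_end n d e) => //; right => u /nP h [c1 c2]; apply: h.
Qed.

(** Two points in a common cell of the first generation are pulled back; this
    stops, and then they are separated by ends of such cells. *)
Lemma decomposed_cut x y : cut x -> cut y -> in01 x -> in01 y ->
  decomposed 0 x y.
Proof.
case: (eqVneq x y) => [-> *|xy]; first exact: decomposed_nil.
have [n nP] := separate xy; elim: n x y xy nP => [|n IH] x y xy nP cx cy x01 y01.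
  by case: (nP [::]) => //; split; exact: cell_nil.
have pull i (d t : R) : cut (sw [:: i] t) -> overlap_end d -> in01 t ->
    decomposed 0 (sw [:: i] d) (sw [:: i] t).
  move=> ct dD t01; have [d01 _] := dD.
  apply: (@decomposed_weak (size [:: i] + 0)) => //; apply: decomposed_map => //.
  by apply: decomposed_overlap => //; exact: cut_pull ct.
case: (pselect (exists i, cell [:: i] x /\ cell [:: i] y)) => [[i [ix iy]]|no].
  have [x1 x101 xE] := cellP ix; have [y1 y101 yE] := cellP iy.
  have xy1 : x1 != y1 by apply: contra_neq xy => e; rewrite xE yE e.
  rewrite xE yE; apply: (@decomposed_weak (size [:: i] + 0)) => //.
  apply: decomposed_map => //; apply: IH => //.
  - move=> u nu [c1 c2]; apply: (nP ([:: i] ++ u)); first by [].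
    by rewrite xE yE !cell_catP.
  - by apply: (@cut_pull [:: i]); rewrite -?xE.
  - by apply: (@cut_pull [:: i]); rewrite -?yE.
have [i [x1 x101 xE]] := sw_cover x01; have [j [y1 y101 yE]] := sw_cover y01.
have ix : cell [:: i] x by rewrite xE; exact: cell_sw.
have jy : cell [:: j] y by rewrite yE; exact: cell_sw.
have niy : ~ cell [:: i] y by move=> h; apply: no; exists i.
have njx : ~ cell [:: j] x by move=> h; apply: no; exists j.
have [f fb] : exists f : bool, btw x y (sw [:: i] f%:R).
  have /orP[h|h] : btw x y (sw [:: i] 0) || btw x y (sw [:: i] 1).
    by move: ix niy; rewrite /cell => + /negP; rewrite /btw; lra.
  - by exists false.
  - by exists true.
set r := sw [:: i] f%:R in fb.
apply: (decomposed_cat fb).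
  apply: decomposed_sym; rewrite xE; apply: pull => //; rewrite -?xE //.
  exact: overlap_bool.
have r01 : in01 r by exact: sw_in01.
case: (pselect (cell [:: j] r)) => [jr|njr].
  have [d d01 dE] := cellP jr; rewrite dE yE; apply: pull; rewrite -?yE //.
  by split => //; exists j, i, f; rewrite -dE.
have [g gb] : exists g : bool, btw r y (sw [:: j] g%:R).
  have /orP[h|h] : btw r y (sw [:: j] 0) || btw r y (sw [:: j] 1).
    by move: jy njr; rewrite /cell => + /negP; rewrite /btw; lra.
  - by exists false.
  - by exists true.
apply: (decomposed_cat gb).
  by apply: decomposed_types; apply: Or33; apply: seed_cut; apply: Or32;
    [exists i, f | exists j, g].
by rewrite yE; apply: pull; rewrite -?yE //; exact: overlap_bool.
Qed.

(** Cutting at the ends of the cells of the first generation makes every word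
    nonempty, hence every map contracting. *)
Lemma decomposed_proper x y : cut x -> cut y -> in01 x -> in01 y ->
  decomposed 1 x y.
Proof.
pose ends := [seq sw [:: p.1] (nat_of_bool p.2)%:R | p <- enum {: 'I_m * bool}].
have endsP i f : sw [:: i] f%:R \in ends.
  by apply/mapP; exists (i, f); rewrite ?mem_enum.
pose strict x y r := (x < r < y) || (y < r < x).
have [n] := ubnP (count (strict x y) ends).
elim: n x y => // n IH x y cn cx cy x01 y01.
case: (pselect (exists2 r, r \in ends & strict x y r)) => [[r re rs]|no].
  have cr : cell_end r by case/mapP: re => -[i f] _ ->; exists i, f.
  have r01 := cell_end_in01 cr.
  have cutr : cut r by right; apply: seed_cut; exact: Or32.
  have fewer a b : (forall t, strict a b t -> strict x y t && (t != r)) ->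
      (count (strict a b) ends < n)%N.
    move=> h; rewrite -ltnS; apply: leq_trans cn; rewrite ltnS.
    exact: (count_lt re rs).
  have rb : btw x y r by move: rs; rewrite /strict /btw; lra.
  apply: (decomposed_cat rb); apply: IH => //; apply: fewer => t.
    by rewrite neq_lt; move: rs; rewrite /strict; lra.
  by rewrite neq_lt; move: rs; rewrite /strict; lra.
have mid : btw x y ((x + y) / 2) by rewrite /btw; case: (lerP x y); lra.
have [i [t t01 tE]] := sw_cover (btw_in01 x01 y01 mid).
have nend f : ~ strict x y (sw [:: i] f%:R).
  by move=> h; apply: no; exists (sw [:: i] f%:R).
have ct := cell_sw [:: i] t01; rewrite -tE in ct.
have [ix iy] : cell [:: i] x /\ cell [:: i] y.
  have := nend false; have := nend true; move: ct.
  rewrite /cell /strict /btw => + /negP + /negP /=; case: (ltrgtP x y); lra.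
have [x1 x101 xE] := cellP ix; have [y1 y101 yE] := cellP iy.
rewrite xE yE -[1%N]/(size [:: i] + 0)%N; apply: decomposed_map => //.
by apply: decomposed_cut => //; [apply: (@cut_pull [:: i]); rewrite -?xE |
  apply: (@cut_pull [:: i]); rewrite -?yE].
Qed.

Fixpoint chain x (l : seq (seq 'I_m * (R * R))) y := if l is s :: l' then
  x = sw s.1 s.2.1 /\ chain (sw s.1 s.2.2) l' y else x = y.

Lemma chain_cat x l a l' y : chain x l a -> chain a l' y -> chain x (l ++ l') y.
Proof. by elim: l x => [|s l IH] x /= => [->|[-> /IH h] /h]. Qed.

Lemma decomposed_chain k x y : decomposed k x y -> exists2 l, chain x l y &
  forall s, s \in l -> [/\ (k <= size s.1)%N, piece s.2.1 s.2.2,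
    btw x y (sw s.1 s.2.1) & btw x y (sw s.1 s.2.2)].
Proof.
elim=> {x y} [x|w x y kw xy|x a y h _ [l1 c1 P1] _ [l2 c2 P2]].
- by exists [::].
- exists [:: (w, (x, y))] => //= s; rewrite inE => /eqP -> /=.
  by split => //; [exact: btwl | exact: btwr].
- exists (l1 ++ l2); first exact: chain_cat c1 c2.
  move=> s; rewrite mem_cat => /orP[/P1|/P2] [? ? b1 b2]; split => //.
  + by apply: btw_trans b1 => //; exact: btwl.
  + by apply: btw_trans b2 => //; exact: btwl.
  + by apply: btw_trans b1 => //; exact: btwr.
  + by apply: btw_trans b2 => //; exact: btwr.
Qed.

Lemma finite_pieces : exists ps : seq (R * R), forall p, p \in ps <-> piece p.1 p.2.
Proof.
have fT : finite_set type_end.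
  apply: (@sub_finite_set _ _ (far true `|` far false `|` seed_pull N)).
    by move=> x [h|h|h]; [left; left|left; right|right].
  by rewrite !finite_setU; split; [split; exact: finite_far|exact: finite_seed_pull].
have [l lE] := (finite_seqP _).1 fT.
have lP x : x \in l <-> type_end x by rewrite lE.
exists [seq p <- [seq (x, y) | x <- l, y <- l] | p.1 != p.2] => -[x y] /=.
rewrite mem_filter.
split=> [/andP[/= xy /allpairsP[[a b] /= [al bl [xa yb]]]]|[tx ty xy]].
  by split => //; [rewrite xa; exact/lP | rewrite yb; exact/lP].
by rewrite /= xy; apply: allpairs_f; exact/lP.
Qed.

End Pieces.

(** ** Rigid systems have finitely many types *)

(** The list consists of the pairs of ends of pieces. The full arc is one of
    them because its ends are overlap ends, and decomposing a piece with
    nonempty words leads to pieces again. *)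
Lemma finite_types (R : realType) (m : nat) (sw : seq 'I_m -> R -> R) :
  (forall w x, in01 x -> in01 (sw w x)) ->
  (forall w x y z, in01 x -> in01 y -> in01 z ->
    btw (sw w x) (sw w y) (sw w z) = btw x y z) ->
  (forall w x y z, in01 x -> in01 y ->
    btw (sw w x) (sw w y) z -> exists2 t, btw x y t & sw w t = z) ->
  (forall x, in01 x -> sw [::] x = x) ->
  (forall u v x, in01 x -> sw (u ++ v) x = sw u (sw v x)) ->
  (forall eta, 0 < eta -> exists n, forall w, (n <= size w)%N ->
    `|sw w 0 - sw w 1| < eta) ->
  (forall x, in01 x -> exists i, exists2 t, in01 t & x = sw [:: i] t) ->
  rigid sw ->
  exists ps : seq (R * R), (0, 1) \in ps /\ forall p, p \in ps ->
    [/\ in01 p.1, in01 p.2, p.1 != p.2 &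
    exists2 l, chain sw p.1 l p.2 & forall s, s \in l ->
      [/\ (0 < size s.1)%N, s.2 \in ps, btw p.1 p.2 (sw s.1 s.2.1) &
         btw p.1 p.2 (sw s.1 s.2.2)]].
Proof.
move=> h1 h2 h3 h4 h5 h6 h7 h8.
have [z [tau [z1 z2 z3]]] := end_cells_exist h1 h2 h3 h4 h5 h6 h7.
have [N NP] := deep_seed_position h2 h5 h6 z tau.
have [ps psP] := finite_pieces h1 h2 h3 h5 h6 h8 z1 z2 N.
exists ps; split.
  apply/psP; split => /=; last by rewrite eq_sym oner_neq0.
  - apply: Or33; apply: (seed_cut h1 h4); apply: Or31.
    exact: (overlap_bool h7 false).
  - apply: Or33; apply: (seed_cut h1 h4); apply: Or31.
    exact: (overlap_bool h7 true).
move=> p /psP[t1 t2 ne].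
have i1 := type_end_in01 t1; have i2 := type_end_in01 t2.
split => //; have := decomposed_proper h1 h2 h3 h4 h5 h6 h7 z1 z2 z3 NP
  (type_end_cut t1) (type_end_cut t2) i1 i2.
move=> /decomposed_chain[l cl lP]; exists l => // s /lP[? ? ? ?].
by split => //; apply/psP.
Qed.

(** * The system acting on the parameter interval *)

Lemma small_pow (R : realType) (k c : R) :
  0 <= k < 1 -> 0 < c -> exists n, k ^+ n < c.
Proof.
move=> /andP[k0 k1] c0.
have := @cvg_expr R k; rewrite ger0_norm //.
move=> /(_ k1) /cvgrPdist_lt /(_ c c0) [n _ h].
exists n; have := h n (leqnn n); rewrite /= sub0r normrN ger0_norm //.
exact: exprn_ge0.
Qed.

Section Dynamics.
Context (R : realType) (gamma : set 'rV[R]_2) (m : nat).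
Variable S : 'I_m -> 'rV[R]_2 -> 'rV[R]_2.
Hypothesis S_affine : forall i, nondegenerate_affine (S i).
Hypothesis S_contracting : forall i, contracting (S i).
Hypothesis gamma_attractor : attractor S gamma.
Variable G : R -> 'rV[R]_2.
Hypothesis cG : continuous G.
Hypothesis iG : forall s t, in01 s -> in01 t -> G s = G t -> s = t.
Hypothesis gammaE : gamma = G @` `[0, 1].
Implicit Types (u v w : seq 'I_m) (s t : R).

Definition Sw w : 'rV[R]_2 -> 'rV[R]_2 := foldr (fun i f => S i \o f) id w.

Lemma gammaP x : gamma x <-> exists2 t, in01 t & G t = x.
Proof.
rewrite gammaE; split=> [[t] | [t t01 <-]].
  by rewrite /= in_itv; exists t.
by exists t; rewrite //= in_itv.
Qed.

Lemma gammaG t : in01 t -> gamma (G t).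
Proof. by move=> t01; apply/gammaP; exists t. Qed.

Lemma gamma_cover x : gamma x <-> exists i, exists2 y, gamma y & x = S i y.
Proof.
have [_ _ e] := gamma_attractor; rewrite {1}e.
split=> [[i _ [y gy <-]]|[i [y gy ->]]].
  by exists i, y.
by exists i => //; exists y.
Qed.

Lemma gamma_Sw w x : gamma x -> gamma (Sw w x).
Proof.
elim: w x => //= i w IH x gx; apply/gamma_cover; exists i, (Sw w x) => //.
exact: IH.
Qed.

Lemma Sw_cat u v x : Sw (u ++ v) x = Sw u (Sw v x).
Proof. by elim: u => //= i u ->. Qed.

Lemma Sw_affine w : nondegenerate_affine (Sw w).
Proof.
elim: w => [|i w [A [b [uA AE]]]] /=.
  by exists 1%:M, 0; split=> [|x]; rewrite ?unitmx1 // mulmx1 addr0.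
have [B [c [uB BE]]] := S_affine i; exists (A *m B), (b *m B + c).
split=> [|x]; first by rewrite unitmx_mul uA.
by rewrite /= AE BE mulmxDl mulmxA addrA.
Qed.

Lemma affine_inj (f : 'rV[R]_2 -> 'rV[R]_2) : nondegenerate_affine f -> injective f.
Proof.
move=> [A [b [uA AE]]] x y; rewrite !AE => /addIr h.
by rewrite -[x](mulmxK uA) h mulmxK.
Qed.

Lemma fld_continuous (L : 'M[R]_2) (b : 'rV[R]_2) (F : R -> 'rV[R]_2) :
  continuous F -> continuous (fun t => fld L b (F t)).
Proof.
move=> cF t; apply/cvgrPdist_lt => e e0.
have A0 : 0 < 2 * (`|L| + 1) by rewrite mulr_gt0 // ltr_wpDl.
have e' : 0 < e / (2 * (`|L| + 1)) by rewrite divr_gt0.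
apply: filterS (cvgr_dist_lt _ _ (cF t) _ e') => s.
rewrite ltr_pdivlMr // /fld opprD addrACA subrr addr0 -mulmxBl => h.
apply: le_lt_trans (mulmx_norm _ _) _; apply: le_lt_trans h.
by have := normr_ge0 (F t - F s); have := normr_ge0 L; nra.
Qed.

Lemma Sw_contracting : exists k, 0 <= k < 1 /\ forall w x y,
  enorm (Sw w x - Sw w y) <= k ^+ size w * enorm (x - y).
Proof.
have /choice[g gP] := S_contracting.
pose k := \big[Num.max/0]_i g i.
have k0 : 0 <= k by exact: bigmax_ge_id.
exists k; split.
  by rewrite k0; apply/bigmax_ltP; split => // i _; case: (gP i).
elim=> [|i w IH] x y /=; first by rewrite mul1r.
have [_ _ h] := gP i; apply: le_trans (h _ _) _.
rewrite exprS -mulrA; apply: ler_pM (IH x y); rewrite ?enorm_ge0 //.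
- by have [] := gP i.
- exact: le_bigmax.
Qed.

(** The map [Sw w] of the arc read in the parameter. *)
Definition sw w t := xget 0 [set s | in01 s /\ G s = Sw w (G (clamp t))].

Lemma sw_spec w t : in01 (sw w t) /\ G (sw w t) = Sw w (G (clamp t)).
Proof.
have [s s01 e] : exists2 s, in01 s & G s = Sw w (G (clamp t)).
  by apply/gammaP/gamma_Sw/gammaG; exact: clamp_itv.
by rewrite /sw; case: xgetP => [y _ //|none]; case: (none s).
Qed.

Lemma sw_in01 w t : in01 (sw w t). Proof. by have [] := sw_spec w t. Qed.

Lemma G_sw w t : in01 t -> G (sw w t) = Sw w (G t).
Proof. by move=> t01; have [_ ->] := sw_spec w t; rewrite clamp_id. Qed.

Lemma sw_nil t : in01 t -> sw [::] t = t.
Proof. by move=> t01; apply: iG => //; rewrite ?G_sw // sw_in01. Qed.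

Lemma sw_cat u v t : in01 t -> sw (u ++ v) t = sw u (sw v t).
Proof.
move=> t01; apply: iG; rewrite ?sw_in01 // !G_sw ?sw_in01 //.
exact: Sw_cat.
Qed.

Lemma continuous_lift (F : R -> 'rV[R]_2) (f : R -> R) : continuous F ->
  (forall t, in01 (f t) /\ G (f t) = F t) -> continuous f.
Proof.
move=> cF fP t; apply/cvgrPdist_lt => e e0 /=.
have [rho rho0 H] := param_modulus cG (fun t => @cvg_id _ (nbhs t)) e0 iG.
apply: filterS (cvgr_dist_lt _ _ (cF t) _ rho0) => s.
have [t01 tE] := fP t; have [s01 sE] := fP s.
by rewrite -tE -sE; exact: H.
Qed.

Lemma sw_continuous w : continuous (sw w).
Proof.
have [A [b [_ AE]]] := Sw_affine w.
apply: (@continuous_lift (fun t => fld A b (G (clamp t)))) => [|t]; last first.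
  by rewrite /fld -AE; exact: sw_spec.
apply: (@fld_continuous A b (G \o @clamp R)).
move=> t; apply: (@cvg_comp _ _ _ (@clamp R) G); last exact: cG.
exact: clamp_continuous.
Qed.

Lemma sw_injective w s t : in01 s -> in01 t -> sw w s = sw w t -> s = t.
Proof.
move=> s01 t01 e; apply: iG => //; apply: (affine_inj (Sw_affine w)).
by rewrite -!G_sw // e.
Qed.

Lemma sw_btw w s t r : in01 s -> in01 t -> in01 r ->
  btw (sw w s) (sw w t) (sw w r) = btw s t r.
Proof. apply: inj_cont_btw; [exact: sw_continuous | exact: sw_injective]. Qed.

Lemma sw_ivt w s t r : in01 s -> in01 t -> btw (sw w s) (sw w t) r ->
  exists2 q, btw s t q & sw w q = r.
Proof. by move=> _ _; apply: btw_ivt; exact: sw_continuous. Qed.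

Lemma sw_cover t : in01 t -> exists i, exists2 s, in01 s & t = sw [:: i] s.
Proof.
move=> t01; have /gamma_cover[i [y /gammaP[s s01 <-] e]] := gammaG t01.
by exists i, s => //; apply: iG; rewrite ?sw_in01 // G_sw.
Qed.

Lemma sw_mesh eta : 0 < eta -> exists n, forall w, (n <= size w)%N ->
  `|sw w 0 - sw w 1| < eta.
Proof.
move=> eta0.
have [rho rho0 H] := param_modulus cG (fun t => @cvg_id _ (nbhs t)) eta0 iG.
have [k [k01 kP]] := Sw_contracting; have [k0 k1] := andP k01.
pose d := enorm (G 0 - G 1).
have d1 : 0 < d + 1 by rewrite ltr_wpDl // enorm_ge0.
have [n nP] := small_pow k01 (divr_gt0 rho0 d1).
exists n => w nw; apply: H; [exact: sw_in01 | exact: sw_in01 |].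
rewrite !G_sw ?in01_0 ?in01_1 //.
apply: le_lt_trans (norm_le_enorm _) _; apply: le_lt_trans (kP _ _ _) _.
rewrite ltr_pdivlMr // in nP; apply: le_lt_trans nP.
have kn : k ^+ size w <= k ^+ n by apply: ler_wiXn2l => //; exact: ltW.
have := exprn_ge0 (size w) k0; have := enorm_ge0 (G 0 - G 1); rewrite -/d.
by nra.
Qed.

(** ** Consequences of not being a segment *)

Hypothesis gamma_arc : jordan_arc gamma.
Hypothesis gamma_not_segment : ~ line_segment gamma.

Lemma cell_inside a b : in01 a -> in01 b -> a != b ->
  exists w, forall t, in01 t -> btw a b (sw w t).
Proof.
move=> a01 b01 ab.
have d0 : 0 < `|a - b| / 2 by rewrite divr_gt0 // normr_gt0 subr_eq0.
have [n nP] := sw_mesh d0.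
have mid : btw a b ((a + b) / 2) by rewrite /btw; case: (lerP a b); lra.
have [w sz cw] := deep_cell (fun w t _ => sw_in01 w t) sw_btw sw_nil
  sw_cat sw_cover n (btw_in01 a01 b01 mid).
exists w => t t01; have := cell_dist (cell_sw sw_btw w t01) cw.
have := nP w; rewrite sz => /(_ (leqnn _)) h1 h2.
have := le_lt_trans h2 h1; rewrite ltr_norml /btw.
by case: (lerP a b); lra.
Qed.

(** Every subarc contains an affine copy of the arc. *)
Lemma subarc_not_in_line a b n1 n2 c : in01 a -> in01 b -> a != b ->
  n1 ^+ 2 + n2 ^+ 2 != 0 ->
  exists2 t, btw a b t & n1 * G t 0 0 + n2 * G t 0 1 != c.
Proof.
move=> a01 b01 ab n0; apply: contrapT => none.
have on t : btw a b t -> n1 * G t 0 0 + n2 * G t 0 1 = c.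
  by move=> h; apply/eqP/negPn/negP => e; apply: none; exists t.
have [w wP] := cell_inside a01 b01 ab.
have [A [v [uA AE]]] := Sw_affine w.
apply: gamma_not_segment; apply: (@arc_in_line _ _
  (A 0 0 * n1 + A 0 1 * n2) (A 1 0 * n1 + A 1 1 * n2)
  (c - n1 * v 0 0 - n2 * v 0 1)) => //.
  apply/eqP => h.
  have : \det A != 0 by move: uA; rewrite unitmxE unitfE.
  rewrite det2E => dA.
  have h1 : A 0 0 * n1 + A 0 1 * n2 = 0.
    by apply/eqP; rewrite -sqrf_eq0; apply/eqP;
       have := sqr_ge0 (A 1 0 * n1 + A 1 1 * n2);
       have := sqr_ge0 (A 0 0 * n1 + A 0 1 * n2); lra.
  have h2 : A 1 0 * n1 + A 1 1 * n2 = 0.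
    by apply/eqP; rewrite -sqrf_eq0; apply/eqP; move: h; rewrite h1; lra.
  have e1 : (A 0 0 * A 1 1 - A 0 1 * A 1 0) * n1 = 0.
    transitivity ((A 0 0 * n1 + A 0 1 * n2) * A 1 1
      - (A 1 0 * n1 + A 1 1 * n2) * A 0 1); first ring.
    by rewrite h1 h2 !mul0r subrr.
  have e2 : (A 0 0 * A 1 1 - A 0 1 * A 1 0) * n2 = 0.
    transitivity ((A 1 0 * n1 + A 1 1 * n2) * A 0 0
      - (A 0 0 * n1 + A 0 1 * n2) * A 1 0); first ring.
    by rewrite h1 h2 !mul0r subrr.
  move/eqP: e1; rewrite mulf_eq0 (negPf dA) => /eqP e1.
  move/eqP: e2; rewrite mulf_eq0 (negPf dA) => /eqP e2.
  by move: n0; rewrite e1 e2 expr0n addr0 eqxx.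
move=> x /gammaP[t t01 <-]; rewrite -(on _ (wP t t01)) G_sw // AE !(mulmx2E, mxE).
ring.
Qed.

Lemma subarc_triangle a b : in01 a -> in01 b -> a != b ->
  exists2 t, btw a b t & omega (G b - G a) (G t - G a) != 0.
Proof.
move=> a01 b01 ab.
have [|t tb h] := @subarc_not_in_line a b (- (G b - G a) 0 1) ((G b - G a) 0 0)
    ((G b - G a) 0 0 * G a 0 1 - (G b - G a) 0 1 * G a 0 0) a01 b01 ab.
  apply: contra_neq ab => h; apply: iG => //; apply/eqP; rewrite eq_sym -subr_eq0.
  move: h; set v := G b - G a; rewrite sqrrN => h.
  have v0 : v 0 0 = 0.
    by apply/eqP; rewrite -sqrf_eq0; apply/eqP; have := sqr_ge0 (v 0 0);
      have := sqr_ge0 (v 0 1); lra.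
  have v1 : v 0 1 = 0.
    by apply/eqP; rewrite -sqrf_eq0; apply/eqP; move: h; rewrite v0; lra.
  by apply/eqP/row2P; rewrite [RHS]mxE.
exists t => //; apply: contra_neq h; rewrite /omega ![(G t - _) _ _]mxE.
by rewrite ![(- G a) _ _]mxE; lra.
Qed.

Lemma fld_nonzero (L : 'M[R]_2) (v : 'rV[R]_2) a b : in01 a -> in01 b -> a != b ->
  ~ (L = 0 /\ v = 0) -> exists2 t, btw a b t & fld L v (G t) != 0.
Proof.
move=> a01 b01 ab nz; apply: contrapT => none.
have zero t : btw a b t -> fld L v (G t) = 0.
  by move=> h; apply/eqP/negPn/negP => e; apply: none; exists t.
have L0 : L = 0.
  have col j : L 0 j ^+ 2 + L 1 j ^+ 2 = 0.
    apply/eqP/negPn/negP => n0.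
    have [t tb /eqP] := @subarc_not_in_line a b _ _ (- v 0 j) a01 b01 ab n0.
    apply; have /matrixP/(_ 0 j) := zero t tb.
    by rewrite /fld !(mulmx2E, mxE); lra.
  have c0 j : L 0 j = 0.
    by apply/eqP; rewrite -sqrf_eq0; apply/eqP; have := col j;
      have := sqr_ge0 (L 0 j); have := sqr_ge0 (L 1 j); lra.
  have c1 j : L 1 j = 0.
    by apply/eqP; rewrite -sqrf_eq0; apply/eqP; have := col j; rewrite c0; lra.
  by apply/matrixP => i j; rewrite [RHS]mxE; case: (ord2P i) => ->.
apply: nz; split => //; have := zero a (btwl _ _).
by rewrite /fld L0 mulmx0 add0r.
Qed.

Lemma gamma_bounded : exists2 M, 0 < M & forall t, in01 t -> `|G t| <= M.
Proof.
have [_ cgamma _] := gamma_attractor.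
have [M [_ h]] := compact_bounded cgamma.
exists (Num.max 1 (M + 1)); first by rewrite lt_max ltr01.
move=> t t01; apply: (h (Num.max 1 (M + 1))); last exact: gammaG.
by rewrite lt_max ltrDl ltr01 orbT.
Qed.

(** An affine map is determined linearly by the images of three points that are
    not collinear. *)
Lemma affine_bound (p0 p1 p2 : 'rV[R]_2) : omega (p1 - p0) (p2 - p0) != 0 ->
  exists2 C, 0 < C & forall (A : 'M[R]_2) (v : 'rV[R]_2) M,
    `|p0 *m A + v| <= M -> `|p1 *m A + v| <= M -> `|p2 *m A + v| <= M ->
    `|A| <= C * M /\ `|v| <= C * M.
Proof.
move=> w0; pose P : 'M[R]_2 :=
  \matrix_(i, j) (if i == 0 then p1 - p0 else p2 - p0) 0 j.
have uP : P \in unitmx.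
  by rewrite unitmxE unitfE det2E !mxE /=; move: w0; rewrite /omega !mxE.
pose C1 := 4 * `|invmx P|.
have C10 : 0 <= C1 by rewrite mulr_ge0.
exists (C1 + 2 * `|p0| * C1 + 1).
  by rewrite ltr_wpDl // addr_ge0 // !mulr_ge0.
move=> A v M h0 h1 h2.
have M0 : 0 <= M := le_trans (normr_ge0 _) h0.
have AE : `|A| <= C1 * M.
  rewrite -(mulKmx uP A); apply: le_trans (mulmx_norm _ _) _.
  have : `|P *m A| <= 2 * M.
    apply: norm_entries => [|i j]; first by rewrite mulr_ge0.
    have d (p : 'rV[R]_2) : `|p *m A + v| <= M -> `|((p - p0) *m A) 0 j| <= 2 * M.
      move=> hp; rewrite (_ : (p - p0) *m A = (p *m A + v) - (p0 *m A + v)).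
        apply: le_trans (entry_norm _ _ _) _; apply: le_trans (ler_normB _ _) _.
        by lra.
      by rewrite mulmxBl opprD addrACA subrr addr0.
    case: (ord2P i) => ->.
      rewrite (_ : (P *m A) 0 j = ((p1 - p0) *m A) 0 j); first exact: d.
      by rewrite !mulmx2E !mxE.
    rewrite (_ : (P *m A) 1 j = ((p2 - p0) *m A) 0 j); first exact: d.
    by rewrite !mulmx2E !mxE.
  by rewrite /C1; have := normr_ge0 (invmx P); nra.
split.
  have : 0 <= 2 * `|p0| * C1 * M by rewrite !mulr_ge0.
  by lra.
have := ler_normB (p0 *m A + v) (p0 *m A); rewrite addrC addKr => hv.
have : `|p0 *m A| <= 2 * `|p0| * (C1 * M).
  by apply: le_trans (mulmx_norm _ _) _; rewrite ler_wpM2l // mulr_ge0.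
have : 0 <= C1 * M by rewrite mulr_ge0.
by lra.
Qed.

(** ** Infinitely many overlaps give maps close to the identity *)

(** The map is [Sw v]^-1 \o [Sw w], which identifies the parameters at which the
    two cells overlap. *)
Lemma overlap_map w v : exists (A : 'M[R]_2) (c : 'rV[R]_2), A \in unitmx /\
  forall r r', in01 r -> in01 r' -> (G r *m A + c = G r' <-> sw w r = sw v r').
Proof.
have [A [a [uA AE]]] := Sw_affine w; have [B [b [uB BE]]] := Sw_affine v.
exists (A *m invmx B), ((a - b) *m invmx B).
split=> [|r r' r01 r'01]; first by rewrite unitmx_mul uA unitmx_inv.
rewrite mulmxA -mulmxDl addrA -AE; split=> [h|h].
  apply: iG; rewrite ?sw_in01 // !G_sw // BE -h mulmxKV //.
  by rewrite subrK.
have : G (sw w r) = G (sw v r') by rewrite h.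
by rewrite !G_sw // BE => ->; rewrite addrK mulmxK.
Qed.

Definition inner_point (e : bool) (delta : R) : R := if e then 1 - delta else delta.

Lemma inner_point_btw (e : bool) delta x :
  0 < delta -> in01 x -> delta <= `|x - e%:R| ->
  [/\ in01 (inner_point e delta), inner_point e delta != e%:R &
      btw x e%:R (inner_point e delta)].
Proof.
rewrite /inner_point /in01 /btw => d0 x01; case: e => /=.
  rewrite ler0_norm; last lra.
  by move=> h; split; [lra | rewrite neq_lt; lra | lra].
rewrite subr0 ger0_norm; last lra.
by move=> h; split; [lra | rewrite neq_lt; lra | lra].
Qed.

(** Infinitely many positions give infinitely many overlap maps [h]. They send
    three fixed points that are not collinear into the arc, and so do their
    inverses; hence they form a bounded family, two of them are close, and the
    quotient of these two is a displacement close to zero. It is not zero since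
    the overlap map determines the position, and it keeps a definite subarc
    inside the arc since the overlaps have definite size. *)
Lemma near_identity : ~ rigid sw -> exists2 d, 0 < d & forall eps, 0 < eps ->
  exists L b s t, [/\ in01 s /\ in01 t, d <= `|s - t|, `|L| < eps /\ `|b| < eps,
    ~ (L = 0 /\ b = 0) &
    forall r, btw s t r -> gamma (G r + fld L b (G r))].
Proof.
rewrite /rigid => /existsNP[e /existsNP[e' /existsNP[delta /not_implyP[delta0]]]].
set Y := [set x | _] => infY.
have [x [xY xinj]] : exists x : nat -> R, (forall n, Y (x n)) /\ injective x.
  have /infiniteP/pcard_leP[f] := infY.
  exists f; split => [n|n n' fE]; first exact: funS.
  by apply: (@inj _ _ [set: nat] f) => //; rewrite inE.
have hxP n : exists h : 'M[R]_2 * 'rV[R]_2, [/\ h.1 \in unitmx,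
    G (x n) *m h.1 + h.2 = G e'%:R,
    forall r, btw e%:R (inner_point e delta) r -> gamma (G r *m h.1 + h.2) &
    exists t, [/\ in01 t, G t *m h.1 + h.2 = G (inner_point e' delta),
      forall r, btw (x n) t r -> exists2 r',
        btw e'%:R (inner_point e' delta) r' & G r *m h.1 + h.2 = G r' &
      forall r', btw e'%:R (inner_point e' delta) r' -> exists2 r,
        in01 r & G r *m h.1 + h.2 = G r']].
  have [xn01 [w [v [y [y01 xE yE dx dy]]]]] := xY n.
  have [A [c [uA AE]]] := overlap_map w v.
  have [i01 _ ib] := inner_point_btw delta0 xn01 dx.
  have [i'01 _ ib'] := inner_point_btw delta0 y01 dy.
  have back r' : btw e'%:R (inner_point e' delta) r' ->
      exists2 r, in01 r & sw w r = sw v r'.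
    move=> h; have r'01 := btw_in01 (in01_bool _ e') i'01 h.
    have : btw (sw w (x n)) (sw w e%:R) (sw v r').
      rewrite xE yE sw_btw ?in01_bool //.
      by apply: btw_trans h; [exact: btwl | rewrite btwC].
    by move=> /sw_ivt[||r rb <-]; rewrite ?in01_bool //; exists r => //;
      apply: btw_in01 rb; rewrite ?in01_bool.
  have [t t01 tE] := back _ (btwr _ _).
  exists (A, c); split => //=.
  - by apply/AE; rewrite ?in01_bool.
  - move=> r hr; have r01 := btw_in01 (in01_bool _ e) i01 hr.
    have : btw (sw v e'%:R) (sw v y) (sw w r).
      rewrite -xE -yE sw_btw ?in01_bool //.
      by apply: btw_trans hr; [exact: btwr | ].
    move=> /sw_ivt[||r' rb rE]; rewrite ?in01_bool //.
    have r'01 : in01 r' by apply: btw_in01 rb; rewrite ?in01_bool.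
    by rewrite (AE r r' r01 r'01).2 //; exact: gammaG.
  - exists t; split => //; first by apply/AE.
      move=> r rb; have r01 := btw_in01 xn01 t01 rb.
      have : btw (sw v e'%:R) (sw v (inner_point e' delta)) (sw w r).
        by rewrite -xE -tE sw_btw.
      move=> /sw_ivt[||r' rb' rE]; rewrite ?in01_bool //.
      have r'01 : in01 r' by apply: btw_in01 rb'; rewrite ?in01_bool.
      by exists r' => //; apply/AE.
    move=> r' h; have [r r01 rE] := back r' h.
    have r'01 := btw_in01 (in01_bool _ e') i'01 h.
    by exists r => //; apply/AE.
have [h hP] := choice hxP.
have [M M0 MP] := gamma_bounded.
have gM z : gamma z -> `|z| <= M by move=> /gammaP[t t01 <-]; exact: MP.
have [x001 [w0 [v0 [y0 [y001 _ _ dx0 dy0]]]]] := xY 0%N.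
have [i01 ine ib] := inner_point_btw delta0 x001 dx0.
have [i'01 i'ne ib'] := inner_point_btw delta0 y001 dy0.
(* the maps and their inverses are bounded because they send three fixed
   non-collinear points of the arc into the arc *)
have [C C0 bound] : exists2 C, 0 < C & forall n, `|(h n).1| <= C /\ `|(h n).2| <= C.
  rewrite eq_sym in ine.
  have [r rb rw] := subarc_triangle (in01_bool _ e) i01 ine.
  have [C C0 CP] := affine_bound rw; exists (C * M); first exact: mulr_gt0.
  move=> n; have [_ _ hg _] := hP n.
  by apply: CP; apply/gM/hg => //; [exact: btwl | exact: btwr].
have [C' C'0 bound'] : exists2 C, 0 < C & forall n, `|invmx (h n).1| <= C.
  rewrite eq_sym in i'ne.
  have [r rb rw] := subarc_triangle (in01_bool _ e') i'01 i'ne.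
  have [C1 C10 CP] := affine_bound rw; exists (C1 * M); first exact: mulr_gt0.
  move=> n; have [uh _ _ [t [_ _ _ back]]] := hP n.
  have inv r' : btw e'%:R (inner_point e' delta) r' ->
      `|G r' *m invmx (h n).1 + - ((h n).2 *m invmx (h n).1)| <= M.
    by move=> /back[q q01 <-]; rewrite -mulmxBl addrK mulmxK // MP.
  by case: (CP _ _ _ (inv _ (btwl _ _)) (inv _ (btwr _ _)) (inv _ rb)).
pose c0 := `|G e'%:R - G (inner_point e' delta)|.
have c00 : 0 < c0.
  rewrite normr_gt0 subr_eq0; apply: contra_neq i'ne => /iG -> //.
  exact: in01_bool.
have c1 : 0 < c0 / (2 * C) by rewrite divr_gt0 // mulr_gt0.
have [d d0 dP] := param_modulus (fun t => @cvg_id _ (nbhs t)) cG c1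
  (fun s t _ _ => @congr1 _ _ G s t).
exists d => // eps eps0.
have [n [n' [nn' cl1 cl2]]] : exists n n', [/\ n != n',
    `|(h n').1 - (h n).1| < eps / (2 * C') &
    `|(h n').2 - (h n).2| < eps / (2 * C')].
  by apply: (close_pair C0 bound); rewrite divr_gt0 // mulr_gt0.
have [uh hx _ [_ [_ _ _ back]]] := hP n.
have [uh' hx' _ [t [t01 tE fwd _]]] := hP n'.
exists (((h n').1 - (h n).1) *m invmx (h n).1),
  (((h n').2 - (h n).2) *m invmx (h n).1).
have small p (D : 'M[R]_(p, 2)) : `|D| < eps / (2 * C') ->
    `|D *m invmx (h n).1| < eps.
  rewrite ltr_pdivlMr ?mulr_gt0 // => hD; apply: le_lt_trans hD.
  apply: le_trans (mulmx_norm _ _) _; have := bound' n; have := normr_ge0 D; nra.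
have disp z : z + fld (((h n').1 - (h n).1) *m invmx (h n).1)
    (((h n').2 - (h n).2) *m invmx (h n).1) z =
    ((z *m (h n').1 + (h n').2) - (h n).2) *m invmx (h n).1.
  rewrite /fld mulmxA -mulmxDl -{1}(mulmxK uh z) -mulmxDl; congr (_ *m _).
  by rewrite mulmxBr !addrA (addrC (z *m (h n).1)) addrK.
exists (x n'), t; split.
- by split => //; have [] := xY n'.
- rewrite leNgt; apply/negP => lt; have [x'01 _] := xY n'.
  have := dP _ _ x'01 t01 lt; rewrite ltNge => /negP; apply.
  rewrite ler_pdivrMr ?mulr_gt0 // /c0 -hx' -tE opprD addrACA subrr addr0 -mulmxBl.
  apply: le_trans (mulmx_norm _ _) _; have [hb _] := bound n'.
  by have := normr_ge0 (G (x n') - G t); nra.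
- by split; exact: small.
- move=> [L0 b0]; have := disp (G (x n')); rewrite L0 b0 /fld mulmx0 !addr0 hx'.
  rewrite -hx addrK mulmxK // => /iG e1.
  have [x1 _] := xY n; have [x2 _] := xY n'.
  by move/eqP: nn'; apply; apply: xinj; rewrite e1.
- move=> r rb; rewrite disp; have [r' r'b ->] := fwd r rb.
  by have [q q01 <-] := back r' r'b; rewrite addrK mulmxK //; exact: gammaG.
Qed.

(** A definite subarc contains one of the finitely many cells of some
    generation. *)
Lemma near_identity_cell : ~ rigid sw -> exists w, forall eps, 0 < eps ->
  exists L b, [/\ `|L| < eps, `|b| < eps, ~ (L = 0 /\ b = 0) &
    forall t, in01 t -> gamma (Sw w (G t) + fld L b (Sw w (G t)))].
Proof.
move=> /near_identity[d d0 near].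
have d2 : 0 < d / 2 by rewrite divr_gt0.
have [n nP] := sw_mesh d2.
pose P (w : n.-tuple 'I_m) eps := exists L b, [/\ `|L| < eps, `|b| < eps,
  ~ (L = 0 /\ b = 0) &
    forall t, in01 t -> gamma (Sw w (G t) + fld L b (Sw w (G t)))].
have [|eps eps0|w wP] := @finite_pigeonhole R _ P.
- move=> w e e' ee' [L [b [h1 h2 h3 h4]]]; exists L, b; split => //.
    exact: lt_le_trans ee'.
  exact: lt_le_trans ee'.
- have [L [b [s [t [[s01 t01] st [h1 h2] h3 h4]]]]] := near eps eps0.
  have mid : btw s t ((s + t) / 2) by rewrite /btw; case: (lerP s t); lra.
  have [w sz cw] := deep_cell (fun w t _ => sw_in01 w t) sw_btw sw_nil sw_cat
    sw_cover n (btw_in01 s01 t01 mid).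
  exists (@Tuple n _ w (introT eqP sz)), L, b; split => // r r01 /=.
  rewrite -G_sw //; apply: h4.
  have := cell_dist (cell_sw sw_btw w r01) cw.
  have := nP w; rewrite sz => /(_ (leqnn _)) g1 g2.
  have : `|sw w r - (s + t) / 2| < `|s - t| / 2 by lra.
  by rewrite ltr_norml /btw; case: (lerP s t); lra.
- by exists w.
Qed.

(** ** Renormalisation *)

(** A displacement is written as a step [n] along a field of norm one; [C]
    stands for further conditions on the linear part of that field. *)
Definition small_maps (Q : set 'rV[R]_2) (C : R -> 'M[R]_2 -> Prop) e L b :=
  exists n, [/\ 0 < n < e, Num.max `|L| `|b| = 1, C e L &
    forall x, Q x -> gamma (x + n *: fld L b x)].

Lemma fld_scale n (L : 'M[R]_2) (b x : 'rV[R]_2) :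
  fld (n *: L) (n *: b) x = n *: fld L b x.
Proof. by rewrite /fld scalerDr -scalemxAr. Qed.

Lemma normalise (L : 'M[R]_2) (b : 'rV[R]_2) : ~ (L = 0 /\ b = 0) ->
  0 < Num.max `|L| `|b| /\ Num.max `|(Num.max `|L| `|b|)^-1 *: L|
    `|(Num.max `|L| `|b|)^-1 *: b| = 1.
Proof.
move=> nz; set n := Num.max _ _.
have n0 : 0 < n.
  rewrite lt_max !normr_gt0 -negb_and; apply/negP => /andP[/eqP h1 /eqP h2].
  exact: nz.
split => //; rewrite !normrZ gtr0_norm ?invr_gt0 //.
rewrite -maxr_pMr ?invr_ge0 ?(ltW n0) //.
by rewrite -/n mulVf // gt_eqF.
Qed.

Lemma limit_field Q (C : R -> 'M[R]_2 -> Prop) :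
  (forall e e' L, e <= e' -> C e L -> C e' L) ->
  (forall e, 0 < e -> exists L b, small_maps Q C e L b) ->
  exists L0 b0, ~ (L0 = 0 /\ b0 = 0) /\ forall e, 0 < e -> exists L b,
    [/\ small_maps Q C e L b, `|L - L0| < e & `|b - b0| < e].
Proof.
move=> Cmono ex; have [||L0 [b0 acc]] := @fields_cluster R (small_maps Q C).
- move=> e e' L b ee' [n [/andP[n0 ne] h1 h2 h3]]; exists n; split => //.
    by rewrite n0 (lt_le_trans ne).
  exact: Cmono h2.
- move=> e /ex[L [b h]]; exists L, b; split => //; case: h => n [_ <- _ _].
    by rewrite le_max lexx.
  by rewrite le_max lexx orbT.
exists L0, b0; split => // -[L00 b00].
have [L [b [[n [_ h _ _]]]]] := acc (1 / 2) (divr_gt0 ltr01 (ltr0Sn _ _)).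
rewrite L00 b00 !subr0 => h1 h2.
have : Num.max `|L| `|b| < 1 / 2 by rewrite gt_max h1.
by rewrite h; lra.
Qed.

Lemma sw_fixed w : exists2 t, in01 t & sw w t = t.
Proof.
have cf : continuous (fun t => sw w t - t).
  by move=> t; apply: cvgB; [exact: sw_continuous | exact: cvg_id].
have := sw_in01 w 0; have := sw_in01 w 1; rewrite /in01 => h1 h0.
have [|t tb tE] := @btw_ivt R (fun t => sw w t - t) 0 1 0 cf.
  by rewrite /btw; lra.
exists t; first by move: tb; rewrite /btw /in01; lra.
by apply/eqP; rewrite -subr_eq0 tE.
Qed.

(** Fixed points of words are dense in the arc, and the zeros of a nonzero field
    lie on a line. *)
Lemma fixed_nonzero w (L : 'M[R]_2) (b : 'rV[R]_2) : ~ (L = 0 /\ b = 0) ->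
  exists u t, [/\ (0 < size u)%N, in01 t, sw (w ++ u) t = t & fld L b (G t) != 0].
Proof.
move=> nz; have w01 : sw w 0 != sw w 1.
  apply/eqP => /sw_injective -/(_ (in01_0 R) (in01_1 R)) /eqP.
  by rewrite eq_sym oner_eq0.
have [r rb rnz] := fld_nonzero (sw_in01 w 0) (sw_in01 w 1) w01 nz.
have r01 := btw_in01 (sw_in01 w 0) (sw_in01 w 1) rb.
have cF : continuous (fun t => fld L b (G t)) by exact: fld_continuous.
have nr : 0 < `|fld L b (G r)| by rewrite normr_gt0.
have [rho rho0 H] := param_modulus (fun t => @cvg_id _ (nbhs t)) cF nr
  (fun s t _ _ => @congr1 _ _ (fun t => fld L b (G t)) s t).
have [n nP] := sw_mesh rho0.
have [q qb qE] := sw_ivt (in01_0 R) (in01_1 R) rb.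
have q01 := btw_in01 (in01_0 R) (in01_1 R) qb.
have [u sz cu] := deep_cell (fun w t _ => sw_in01 w t) sw_btw sw_nil sw_cat
    sw_cover n.+1 q01.
have [t t01 tE] := sw_fixed (w ++ u); exists u, t; split => //; first by rewrite sz.
apply/eqP => h; have := H r t r01 t01.
rewrite h subr0 ltxx => /(_ _)/notF; apply.
apply: le_lt_trans (nP (w ++ u) _); last first.
  by rewrite size_cat sz addnS ltnW // ltnS leq_addl.
apply: (@cell_dist _ _ sw (w ++ u)).
  by rewrite -qE (cell_catP (fun w t _ => sw_in01 w t) sw_btw sw_cat).
by have := cell_sw sw_btw (w ++ u) t01; rewrite tE.
Qed.

Lemma iter_word w t n : in01 t -> sw w t = t -> (0 < size w)%N ->
  exists v, [/\ (n <= size v)%N, sw v t = t & exists v', v = w ++ v'].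
Proof.
move=> t01 tE w0; elim: n => [|n [v [sv vE _]]].
  by exists w; split => //; exists [::]; rewrite cats0.
exists (w ++ v); split; last by exists v.
  rewrite size_cat; case: (size w) w0 => // k _.
  by rewrite addSn ltnS (leq_trans sv) // leq_addl.
by rewrite sw_cat // vE.
Qed.

(** The image of the middle part stays away from the ends of its cell, so being
    close to it in the plane forces a point of the arc into this cell. *)
Lemma middle_cell v : exists2 rho, 0 < rho & forall t x, middle t -> gamma x ->
  `|x - Sw v (G t)| < rho -> exists2 q, in01 q & x = Sw v (G q).
Proof.
have q01 : in01 (1 / 4 : R) by rewrite /in01; lra.
have q02 : in01 (3 / 4 : R) by rewrite /in01; lra.
pose d := Num.min `|sw v (1 / 4) - sw v 0| `|sw v (3 / 4) - sw v 1|.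
have d0 : 0 < d.
  rewrite lt_min !normr_gt0 !subr_eq0; apply/andP; split; apply/eqP;
    move/sw_injective => h.
  - by have := h q01 (in01_0 R); lra.
  - by have := h q02 (in01_1 R); lra.
have [rho rho0 H] := param_modulus cG (fun t => @cvg_id _ (nbhs t)) d0 iG.
exists rho => // t x tm /gammaP[r r01 <-] hr.
have t01 : in01 t by move: tm; rewrite /middle /in01; lra.
rewrite -G_sw // in hr; have := H _ _ r01 (sw_in01 v t) hr.
rewrite lt_min => /andP[g1 g2].
have b1 : btw (sw v (1 / 4)) (sw v (3 / 4)) (sw v t).
  by rewrite sw_btw //; move: tm; rewrite /middle /btw; lra.
have b2 : btw (sw v 0) (sw v (3 / 4)) (sw v (1 / 4)).
  by rewrite sw_btw ?in01_0 // /btw; lra.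
have b3 : btw (sw v (1 / 4)) (sw v 1) (sw v (3 / 4)).
  by rewrite sw_btw ?in01_1 // /btw; lra.
have b4 : btw (sw v 0) (sw v 1) (sw v (1 / 4)).
  by rewrite sw_btw ?in01_0 ?in01_1 // /btw; lra.
have [|q qb qE] := @sw_ivt v 0 1 r (in01_0 R) (in01_1 R).
  move: g1 g2 b1 b2 b3 b4; rewrite /btw.
  by case: (lerP (sw v 0) (sw v (1 / 4))); case: (lerP (sw v 1) (sw v (3 / 4)));
    rewrite !ltr_norml; lra.
have q001 := btw_in01 (in01_0 R) (in01_1 R) qb.
by exists q => //; rewrite -G_sw // qE.
Qed.

Definition almost_nilpotent (e : R) (L : 'M[R]_2) :=
  `|\tr L| <= e /\ `|\det L| <= e.

Lemma conj_field (L A : 'M[R]_2) (b c x : 'rV[R]_2) : A \in unitmx ->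
  fld (A *m L *m invmx A) (fld L b c *m invmx A) x *m A = fld L b (x *m A + c).
Proof.
by move=> uA; rewrite /fld mulmxDl -mulmxA !mulmxKV // mulmxDl mulmxA addrA.
Qed.

(** Conjugation by a deep word [v] whose fixed point is not a zero of the limit
    field enlarges the displacement of this point by a large factor, and changes
    neither the trace nor the determinant of the linear part of the field. After
    normalisation both are small. The conjugate displacement is defined on the
    whole arc but takes values in [Sw v]^-1 of the arc only, which is why it is
    restricted to the middle part. *)
Lemma renormalise : ~ rigid sw -> forall e, 0 < e -> exists L b,
  small_maps [set x | exists2 t, middle t & x = G t] almost_nilpotent e L b.
Proof.
move=> /near_identity_cell[w near].
pose Q := [set x | exists2 t, in01 t & x = Sw w (G t)].
have [||L0 [b0 [nz acc]]] := @limit_field Q (fun _ _ => True) => //.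
  move=> e e0; have [L [b [hL hb nz stay]]] := near e e0.
  have [n0 n1] := normalise nz; set n := Num.max `|L| `|b| in n0 n1.
  exists (n^-1 *: L), (n^-1 *: b), n; split => //.
    by rewrite n0 gt_max hL.
  move=> _ [t t01 ->]; rewrite fld_scale scalerA mulfV ?gt_eqF // scale1r.
  exact: stay.
have [u [t [u0 t01 tE fnz]]] := fixed_nonzero w nz.
set p := G t in fnz; pose c1 := `|fld L0 b0 p| / 2.
have c10 : 0 < c1 by rewrite divr_gt0 // normr_gt0.
have [k [k01 kP]] := Sw_contracting; have [k0 k1] := andP k01.
have [M M0 MP] := gamma_bounded.
move=> e e0; pose B := Num.max 1 (2 / e).
have B1 : 1 <= B by rewrite le_max lexx.
have Be : 2 <= e * B by rewrite mulrC -ler_pdivrMr // le_max lexx orbT.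
have B0 : 0 < B by exact: lt_le_trans B1.
pose D := 2 * (2 * `|p| + 1).
have D0 : 0 < D by rewrite mulr_gt0 // ltr_wpDl // mulr_ge0.
have [n nP] := small_pow k01 (divr_gt0 c10 (mulr_gt0 D0 B0)).
have wu0 : (0 < size (w ++ u))%N by rewrite size_cat addn_gt0 u0 orbT.
have [v [nv vt [v' vE]]] := iter_word n t01 tE wu0.
have [A [c [uA AE]]] := Sw_affine v.
have [rho rho0 rhoP] := middle_cell v.
pose K := 4 * `|A| * `|invmx A| + 2 * (2 * `|c| + 1) * `|invmx A| + 1.
have K0 : 0 < K.
  by rewrite ltr_wpDl // addr_ge0 // !mulr_ge0 // addr_ge0 // mulr_ge0.
have M1 : 0 < 2 * M + 1 by rewrite ltr_wpDl // mulr_ge0 // ltW.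
have p1 : 0 < 2 * `|p| + 1 by rewrite ltr_wpDl // mulr_ge0.
pose e2 := Num.min (e / K) (Num.min (rho / (2 * M + 1)) (c1 / (2 * `|p| + 1))).
have e20 : 0 < e2 by rewrite !lt_min; apply/and3P; split; exact: divr_gt0.
have e2K : e2 * K <= e by rewrite -ler_pdivlMr // ge_min lexx.
have e2M : e2 * (2 * M + 1) <= rho by rewrite -ler_pdivlMr // !ge_min lexx orbT.
have e2p : e2 * (2 * `|p| + 1) <= c1 by rewrite -ler_pdivlMr // !ge_min lexx !orbT.
have [L [b [[N [/andP[N0 Ne] N1 _ stay]] dL db]]] := acc e2 e20.
have L1 : `|L| <= 1 by rewrite -N1 le_max lexx.
have b1 : `|b| <= 1 by rewrite -N1 le_max lexx orbT.
pose L' := A *m L *m invmx A; pose b' := fld L b c *m invmx A.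
pose mu := Num.max `|L'| `|b'|.
have L'mu : `|L'| <= mu by rewrite le_max lexx.
have b'mu : `|b'| <= mu by rewrite le_max lexx orbT.
(* mu is large: the displacement of the fixed point has been expanded *)
have muB : B <= mu.
  have pE : p *m A + c = p by rewrite -AE -G_sw // vt.
  have h1 : c1 <= `|fld L b p|.
    have := fld_norm (L - L0) (b - b0) p; rewrite -fld_sub.
    have := ler_normB (fld L b p) (fld L b p - fld L0 b0 p).
    rewrite opprB addrC subrK.
    have := normr_ge0 p; rewrite /c1 in c10 e2p *; nra.
  have h2 : `|fld L b p| <= k ^+ n * (D * mu).
    apply: le_trans (norm_le_enorm _) _.
    have -> : fld L b p = Sw v (fld L' b' p) - Sw v 0.
      by rewrite !AE mul0mx add0r addrK conj_field // pE.
    apply: le_trans (kP _ _ _) _; rewrite subr0.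
    apply: ler_pM; rewrite ?exprn_ge0 ?enorm_ge0 //.
      by apply: ler_wiXn2l => //; exact: ltW.
    apply: le_trans (enorm_le_norm _) _; have := fld_norm L' b' p.
    by have := normr_ge0 p; rewrite /D; nra.
  rewrite ltr_pdivlMr ?mulr_gt0 // in nP.
  rewrite leNgt; apply/negP => lt.
  have : k ^+ n * (D * mu) <= k ^+ n * (D * B).
    by rewrite ler_wpM2l ?exprn_ge0 // ler_wpM2l ?(ltW D0) // ltW.
  by move: (lt_le_trans nP h1) h2; clear; lra.
have mu0 : 0 < mu by exact: lt_le_trans muB.
have muK : mu <= K.
  have hA := normr_ge0 (invmx A).
  have iA : 0 <= `|A| * `|invmx A| by rewrite mulr_ge0.
  have ic : 0 <= `|c| * `|invmx A| by rewrite mulr_ge0.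
  rewrite ge_max; apply/andP; split.
    apply: le_trans (mulmx_norm _ _) _.
    have : `|A *m L| <= 2 * `|A|.
      by apply: le_trans (mulmx_norm _ _) _; have := normr_ge0 A; nra.
    by move=> h; rewrite /K; nra.
  apply: le_trans (mulmx_norm _ _) _.
  have : `|fld L b c| <= 2 * `|c| + 1.
    by apply: le_trans (fld_norm _ _ _) _; have := normr_ge0 c; nra.
  by move=> h; rewrite /K; nra.
have nz' : ~ (L' = 0 /\ b' = 0).
  by move=> [h1 h2]; move: mu0; rewrite /mu h1 h2 !normr0 maxxx ltxx.
have [_ norm1] := normalise nz'; rewrite -/mu in norm1.
exists (mu^-1 *: L'), (mu^-1 *: b'), (N * mu); split => //.
- rewrite mulr_gt0 //=; apply: lt_le_trans e2K.
  by apply: (@lt_le_trans _ _ (e2 * mu)); rewrite ?ltr_pM2r // ler_pM2l.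
- have mue : 2 / mu <= e by rewrite ler_pdivrMr //; have := ltW e0; nra.
  have mu1 : mu^-1 <= 1 by rewrite invf_le1 //; exact: le_trans muB.
  have imu : 0 < mu^-1 by rewrite invr_gt0.
  have ent i j : `|L i j| <= 1 by rewrite (le_trans (entry_norm _ _ _)).
  split.
    rewrite mxtraceZ /L' mxtrace_mulC mulmxA mulVmx // mul1mx normrM gtr0_norm //.
    apply: le_trans mue; rewrite mulrC ler_wpM2r ?(ltW imu) // tr2E.
    by apply: le_trans (ler_normD _ _) _; have := ent 0 0; have := ent 1 1; lra.
  have detL' : \det L' = \det L.
    by rewrite /L' !det_mulmx det_inv mulrAC mulrV ?mul1r // -unitmxE.
  rewrite detZ detL' normrM ger0_norm ?exprn_ge0 ?(ltW imu) //.
  have : `|\det L| <= 2.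
    rewrite det2E; apply: le_trans (ler_normB _ _) _; rewrite !normrM.
    have : `|L 0 0| * `|L 1 1| <= 1 * 1 by rewrite ler_pM.
    have : `|L 0 1| * `|L 1 0| <= 1 * 1 by rewrite ler_pM.
    by lra.
  have : mu^-1 ^+ 2 <= mu^-1 by rewrite expr2 -[leRHS]mulr1 ler_wpM2l // ltW.
  have := normr_ge0 (\det L); have : 0 <= mu^-1 ^+ 2 by rewrite exprn_ge0 // ltW.
  by move: mue; set d := `|_|; set i := mu^-1; nra.
- move=> _ [s sm ->]; rewrite fld_scale scalerA mulfK ?gt_eqF //.
  have s01 : in01 s by move: sm; rewrite /middle /in01; lra.
  have Qs : Q (Sw v (G s)).
    by exists (sw (u ++ v') s); rewrite ?sw_in01 // G_sw // -Sw_cat catA -vE.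
  have yE : Sw v (G s) + N *: fld L b (Sw v (G s)) =
      Sw v (G s + N *: fld L' b' (G s)).
    by rewrite !AE mulmxDl -scalemxAl conj_field // addrAC.
  have [|q q01 qE] := rhoP s _ sm (stay _ Qs).
    rewrite addrAC subrr add0r normrZ gtr0_norm //; apply: lt_le_trans e2M.
    apply: (@le_lt_trans _ _ (N * (2 * M + 1))); last by rewrite ltr_pM2r.
    rewrite ler_pM2l //; apply: le_trans (fld_norm _ _ _) _.
    have [s' s'01 ->] := Qs; rewrite -G_sw //.
    have := MP _ (sw_in01 w s'); have := normr_ge0 (G (sw w s')); nra.
  move: qE; rewrite yE => /(affine_inj (Sw_affine v)) ->; exact: gammaG.
Qed.

(** The limit field has a nilpotent linear part, so its Hamiltonian is a
    degenerate quadratic function. It is constant on a subarc, hence on a cell,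
    and the map of this cell pulls it back to the whole arc. *)
Lemma not_rigid_parabolic : ~ rigid sw -> parabolic_segment gamma.
Proof.
move=> /renormalise small.
have [|L0 [b0 [nz acc]]] := limit_field _ small.
  by move=> e e' L ee' [h1 h2]; split; exact: le_trans ee'.
have entry e L : `|L - L0| < e -> forall i j, `|L i j - L0 i j| < e.
  move=> h i j; have := entry_norm (L - L0) i j; rewrite !mxE => h2.
  exact: le_lt_trans h.
have le_all (x : R) : (forall e, 0 < e -> `|x| <= e) -> x = 0.
  move=> h; apply/eqP; rewrite -normr_le0; apply/ler_addgt0Pr => e e0.
  by rewrite add0r h.
have tr0 : \tr L0 = 0.
  apply: le_all => e e0.
  have e3 : 0 < e / 3 by rewrite divr_gt0.
  have [L [b [[n [_ _ [tr _] _]] dL _]]] := acc _ e3.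
  move: tr; rewrite !tr2E; have := entry _ _ dL 0 0; have := entry _ _ dL 1 1.
  by rewrite !ltr_norml !ler_norml => *; apply/andP; split; lra.
have det0 : \det L0 = 0.
  apply: le_all => e e0; pose e' := Num.min (e / 7) 1.
  have e'0 : 0 < e' by rewrite lt_min divr_gt0 //=.
  have [L [b [[n [_ N1 [_ dt] _]] dL _]]] := acc _ e'0.
  have e'e : e' <= e / 7 by rewrite ge_min lexx.
  have e'1 : e' <= 1 by rewrite ge_min lexx orbT.
  have ent i j : `|L i j| <= 1.
    by rewrite (le_trans (entry_norm _ _ _)) // -N1 le_max lexx.
  have prod (a a' c c' : R) : `|a| <= 1 -> `|c| <= 1 -> `|a - a'| < e' ->
      `|c - c'| < e' -> `|a' * c' - a * c| <= 3 * e'.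
    move=> ha hc da dc.
    have -> : a' * c' - a * c =
        (a - a') * (c - c') - a * (c - c') - (a - a') * c by ring.
    apply: le_trans (ler_normB _ _) _.
    have := ler_normB ((a - a') * (c - c')) (a * (c - c')); rewrite !normrM.
    have := normr_ge0 a; have := normr_ge0 c; have := normr_ge0 (a - a').
    have := normr_ge0 (c - c'); nra.
  have := prod _ _ _ _ (ent 0 0) (ent 1 1) (entry _ _ dL 0 0) (entry _ _ dL 1 1).
  have := prod _ _ _ _ (ent 0 1) (ent 1 0) (entry _ _ dL 0 1) (entry _ _ dL 1 0).
  move: dt; rewrite !det2E !ler_norml => *; apply/andP; split; lra.
have q1 : in01 (3 / 8 : R) by rewrite /in01; lra.
have q2 : in01 (5 / 8 : R) by rewrite /in01; lra.
have q12 : (3 / 8 : R) != 5 / 8 by rewrite neq_lt; lra.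
have [t0 t0b t0nz] := fld_nonzero q1 q2 q12 nz.
have t0m : 1 / 4 < t0 < 3 / 4 by move: t0b; rewrite /btw; lra.
have [|T0 [T1 [T001 T101 T01 const]]] := ham_constant cG iG tr0 t0m t0nz.
  move=> e /acc[L [b [[n [ne _ _ stay]] dL db]]]; exists n, L, b.
  split => //; try exact: ltW.
  move=> t tm; have /gammaP[s s01 sE] := stay (G t) (ex_intro2 _ _ t tm erefl).
  by exists s.
have [w wP] := cell_inside T001 T101 (negbT (lt_eqF T01)).
have [A [c [uA AE]]] := Sw_affine w.
have dA : \det A != 0 by move: uA; rewrite unitmxE unitfE.
pose L' := A *m L0 *m invmx A; pose b' := fld L0 b0 c *m invmx A.
have eL : L' *m A = A *m L0 by rewrite mulmxKV.
have eb : b' *m A = fld L0 b0 c by rewrite mulmxKV.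
apply: (@ham_arc _ _ L' b' ((ham L0 b0 (G t0) - ham L0 b0 c) / \det A)) => //.
- by rewrite /L' mxtrace_mulC mulmxA mulVmx // mul1mx.
- by rewrite /L' !det_mulmx det0 mulr0 mul0r.
- move=> [L'0 b'0]; apply: nz.
  have L00 : L0 = 0 by rewrite -[L0](mulKmx uA) -eL L'0 mul0mx mulmx0.
  by split => //; move: eb; rewrite b'0 mul0mx /fld L00 mulmx0 add0r.
- move=> x /gammaP[t t01 <-].
  have := const (sw w t); rewrite G_sw // AE (ham_pull _ tr0 eL eb) => <-.
    by rewrite addrK mulrC mulKf.
  by have := wP t t01; rewrite /btw; lra.
Qed.

(** ** The multizipper *)

(** The end of step [k - 1] of the chain, which is the start of step [k]. *)
Definition chain_point x (l : seq (seq 'I_m * (R * R))) k : R :=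
  if k is k'.+1 then let s := nth ([::], (0, 1)) l k' in sw s.1 s.2.2 else x.

Lemma chain_pointP x l y : chain sw x l y ->
  (forall k, (k < size l)%N ->
    chain_point x l k =
      sw (nth ([::], (0, 1)) l k).1 (nth ([::], (0, 1)) l k).2.1) /\
  chain_point x l (size l) = y.
Proof.
elim: l x => [|s l IH] x //= [xE /IH [h1 h2]]; split.
  by case=> [|k] //=; rewrite ltnS => kl; rewrite -h1 //; case: k {kl}.
by rewrite -h2; case: (l) => [|s' l'] //=.
Qed.

Lemma chain_cover x l y t : chain sw x l y -> x != y -> btw x y t ->
  exists2 s : seq 'I_m * (R * R), s \in l & btw (sw s.1 s.2.1) (sw s.1 s.2.2) t.
Proof.
elim: l x => [|s l IH] x /=; first by move=> -> /eqP.
move=> [xE cl] _ bt; case: (eqVneq (sw s.1 s.2.2) y) => [e|ne].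
  by exists s; rewrite ?mem_head // e -xE.
have /orP[h|h] : btw x (sw s.1 s.2.2) t || btw (sw s.1 s.2.2) y t.
  by move: bt; rewrite /btw; lra.
  by exists s; rewrite ?mem_head // -xE.
by have [s' s'l h'] := IH _ cl ne h; exists s' => //; rewrite inE s'l orbT.
Qed.

Lemma Sw_proper_contracting w : (0 < size w)%N -> contracting (Sw w).
Proof.
move=> w0; have [k [/andP[k0 k1] kP]] := Sw_contracting.
exists (k ^+ size w); split; [exact: exprn_ge0 | | exact: kP].
by rewrite exprn_ilt1 // -lt0n.
Qed.

Definition garc x y : set 'rV[R]_2 := G @` [set t | btw x y t].

Lemma garc_compact x y : compact (garc x y).
Proof.
apply: continuous_compact; first exact: continuous_subspaceT.
rewrite (_ : [set t | _] = `[Num.min x y, Num.max x y]%classic).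
  exact: segment_compact.
apply/seteqP; split => t; rewrite /= in_itv /= /btw.
  by case: (lerP x y); lra.
by case: (lerP x y); lra.
Qed.

Lemma Sw_garc w x y : in01 x -> in01 y ->
  Sw w @` garc x y = garc (sw w x) (sw w y).
Proof.
move=> x01 y01; apply/seteqP; split => z.
  move=> [_ [t tb <-] <-]; have t01 := btw_in01 x01 y01 tb.
  by exists (sw w t); rewrite ?G_sw //= sw_btw.
move=> [t /= tb <-]; have [q qb <-] := sw_ivt x01 y01 tb.
have q01 := btw_in01 x01 y01 qb.
by exists (G q); [exists q | rewrite G_sw].
Qed.

(** The vertices are the types; the maps are the [Sw w] with [w] nonempty, which
    are contracting. *)
Lemma multizipper_of_types (ps : seq (R * R)) : (0, 1) \in ps ->
  (forall p, p \in ps -> [/\ in01 p.1, in01 p.2, p.1 != p.2 &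
    exists2 l, chain sw p.1 l p.2 & forall s : seq 'I_m * (R * R), s \in l ->
      [/\ (0 < size s.1)%N, s.2 \in ps, btw p.1 p.2 (sw s.1 s.2.1) &
         btw p.1 p.2 (sw s.1 s.2.2)]]) ->
  exists (Z : multizipper R) (K : mz_vertex Z -> set 'rV[R]_2),
    multizipper_attractor K /\ exists u : mz_vertex Z, K u = gamma.
Proof.
move=> ps01 psP; pose V := 'I_(size ps); pose pq (u : V) := nth (0, 1) ps u.
have pq_ps (u : V) : pq u \in ps by apply: mem_nth.
pose subdivision (u : V) (l : seq (seq 'I_m * (R * R))) :=
  chain sw (pq u).1 l (pq u).2 /\ forall s : seq 'I_m * (R * R), s \in l ->
    [/\ (0 < size s.1)%N, s.2 \in ps, btw (pq u).1 (pq u).2 (sw s.1 s.2.1) &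
       btw (pq u).1 (pq u).2 (sw s.1 s.2.2)].
have /choice[L LP] (u : V) : exists l, subdivision u l.
  by have [_ _ _ [l h1 h2]] := psP _ (pq_ps u); exists l.
pose st (u : V) k := nth ([::], (0, 1)) (L u) k.
have stL (u : V) (i : 'I_(size (L u))) : st u i \in L u by apply: mem_nth.
pose tgt (u : V) (i : 'I_(size (L u))) : V := insubd u (index (st u i).2 ps).
have tgtE (u : V) (i : 'I_(size (L u))) : pq (tgt u i) = (st u i).2.
  have [_ h _ _] := (LP u).2 _ (stL u i).
  by rewrite /pq /tgt val_insubd index_mem h nth_index.
have st01 (u : V) (i : 'I_(size (L u))) : in01 (st u i).2.1 /\ in01 (st u i).2.2.
  by rewrite -tgtE; have [] := psP _ (pq_ps (tgt u i)).
pose pt (u : V) k := chain_point (pq u).1 (L u) k.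
have pt0 (u : V) (i : 'I_(size (L u))) : pt u i = sw (st u i).1 (st u i).2.1.
  by have [h _] := chain_pointP (LP u).1; apply: h.
have ptN (u : V) : pt u (size (L u)) = (pq u).2 by have [] := chain_pointP (LP u).1.
have len0 (u : V) : (0 < size (L u))%N.
  rewrite lt0n; apply/eqP => /size0nil e; have [_ _ /eqP ne _] := psP _ (pq_ps u).
  by have [] := LP u; rewrite e.
have aff (u : V) (i : 'I_(size (L u))) : nondegenerate_affine (Sw (st u i).1).
  exact: Sw_affine.
have contr (u : V) (i : 'I_(size (L u))) : contracting (Sw (st u i).1).
  by apply: Sw_proper_contracting; have [] := (LP u).2 _ (stL u i).
have chainE (u : V) (i : 'I_(size (L u))) :
    Sw (st u i).1 @` [set G (pt (tgt u i) (@ord0 (size (L (tgt u i)))));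
                       G (pt (tgt u i) (@ord_max (size (L (tgt u i)))))] =
    [set G (pt u (widen_ord (leqnSn _) i)); G (pt u (lift ord0 i))].
  have [a01 b01] := st01 u i.
  have e0 : pt (tgt u i) (@ord0 (size (L (tgt u i)))) = (st u i).2.1.
    by rewrite /pt /= tgtE.
  have e1 : pt (tgt u i) (@ord_max (size (L (tgt u i)))) = (st u i).2.2.
    by rewrite /= ptN tgtE.
  by rewrite image_setU !image_set1 e0 e1 -!G_sw // -pt0.
exists (@Multizipper R V (fun u : V => size (L u)) (fun (u : V) k => G (pt u k)) tgt
  (fun (u : V) i => Sw (st u i).1) len0 aff contr chainE).
exists (fun u : V => garc (pq u).1 (pq u).2); split; last first.
  have i01 : (index (0%R : R, 1%R : R) ps < size ps)%N by rewrite index_mem.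
  exists (Ordinal i01); rewrite /pq nth_index //= gammaE /garc.
  congr (_ @` _); apply/seteqP; split => t; rewrite /= in_itv /= /btw; lra.
move=> u; have [p01 q01 pqne _] := psP _ (pq_ps u); split.
- by exists (G (pq u).1); exists (pq u).1 => //=; exact: btwl.
- exact: garc_compact.
apply/seteqP; split => z /=.
  move=> [t tb <-]; have [s sL sb] := chain_cover (LP u).1 pqne tb.
  have iL : (index s (L u) < size (L u))%N by rewrite index_mem.
  have sE : st u (Ordinal iL) = s by rewrite /st nth_index.
  exists (Ordinal iL) => //; rewrite tgtE Sw_garc;
    try by have [] := st01 u (Ordinal iL).
  by rewrite sE; exists t.
move=> [i _]; have [a01 b01] := st01 u i.
rewrite tgtE Sw_garc // => -[t tb <-]; exists t => //=.
have [_ _ h1 h2] := (LP u).2 _ (stL u i).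
exact: btw_trans tb.
Qed.

End Dynamics.

Theorem theorem1 (R : realType) (gamma : set 'rV[R]_2)
    (m : nat) (S : 'I_m -> 'rV[R]_2 -> 'rV[R]_2)
    (S_affine : forall i, nondegenerate_affine (S i))
    (S_contracting : forall i, contracting (S i))
    (gamma_attractor : attractor S gamma)
    (gamma_arc : jordan_arc gamma)
    (gamma_not_parabolic : ~ parabolic_segment gamma) :
  exists (Z : multizipper R) (K : mz_vertex Z -> set 'rV[R]_2),
    multizipper_attractor K /\ exists u : mz_vertex Z, K u = gamma.
Proof.
have [G [cG iG gammaE]] := jordan_param gamma_arc.
have not_segment : ~ line_segment gamma.
  by move=> seg; apply: gamma_not_parabolic; left.
have sw_rigid : rigid (sw S G).
  apply: contrapT => nr; apply: gamma_not_parabolic.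
  exact: (not_rigid_parabolic S_affine S_contracting gamma_attractor cG iG
            gammaE gamma_arc not_segment nr).
have [|||||||ps [ps01 psP]] := finite_types _ _ _ _ _ _ _ sw_rigid.
- by move=> w x _; exact: (sw_in01 gamma_attractor gammaE).
- exact: (sw_btw S_affine gamma_attractor cG iG gammaE).
- exact: (sw_ivt S_affine gamma_attractor cG iG gammaE).
- exact: (sw_nil gamma_attractor iG gammaE).
- exact: (sw_cat gamma_attractor iG gammaE).
- exact: (sw_mesh S_contracting gamma_attractor cG iG gammaE).
- exact: (sw_cover gamma_attractor iG gammaE).
exact: (multizipper_of_types S_affine S_contracting gamma_attractor cG iG
          gammaE ps01 psP).
Qed.
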